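(* Let $p$ be an odd prime, let $n\ge3$ be an odd integer, and let $f:\mathbb{F}_p^n\to\mathbb{F}_p$ be a non-weakly regular bent function belonging to $\mathcal{DBF}$. Let $P$ and $D$ be the sets of all nonempty members of, respectively, $$\mathcal{P}=\{\{0\},\,c_0(f)\setminus\{0\},\,c_1(f),\dots,c_{p-1}(f),\,d_0(f)\setminus\{0\},\,d_1(f),\dots,d_{p-1}(f)\},$$ $$\mathcal{D}=\Big\{\{0\},\,c_0(f)\setminus\{0\},\,\bigcup_{i\in SQ}c_i(f),\,\bigcup_{i\in NSQ}c_i(f),\,d_0(f)\setminus\{0\},\,\bigcup_{i\in SQ}d_i(f),\,\bigcup_{i\in NSQ}d_i(f)\Big\}.$$ (1) If $B_+(f^* )$ is a non-degenerate $r$-dimensional subspace over $\mathbb{F}_p$ with $\frac{n+1}2\le r\le n-1$, then, for each of the two partitions $P$, $D$ of $\mathbb{F}_p^n$, the partition induces a symmetric association scheme if and only if $r=\frac{n+1}2$. (2) If $B_-(f^* )$ is a non-degenerate $r$-dimensional subspace over $\mathbb{F}_p$ with $\frac{n+1}2\le r\le n-1$, then, for each of the two partitions $P$, $D$ of $\mathbb{F}_p^n$, the partition induces a symmetric association scheme if and only if $r=\frac{n+1}2$.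
   Context: Let $p$ be an odd prime, $n$ a positive integer, $x\cdot y$ the ordinary inner product on $\mathbb{F}_p^n$, and $\xi_p=e^{2\pi\sqrt{-1}/p}$. $SQ$ and $NSQ$ denote the sets of squares and of nonsquares in $\mathbb{F}_p^*$. Bent functions. For $f:\mathbb{F}_p^n\to\mathbb{F}_p$ the Walsh transform is $\mathcal{W}_f(\alpha)=\sum_{x\in\mathbb{F}_p^n}\xi_p^{f(x)-\alpha\cdot x}$, $\alpha\in\mathbb{F}_p^n$; $f$ is bent if $|\mathcal{W}_f(\alpha)|=p^{n/2}$ for all $\alpha$. Put $\mu=1$ if $p^n\equiv1\pmod 4$ and $\mu=\sqrt{-1}$ if $p^n\equiv3\pmod4$. For a bent $f$ it is known that for every $\alpha$, $\mathcal{W}_f(\alpha)\in\{\mu p^{n/2}\xi_p^{f^*(\alpha)},-\mu p^{n/2}\xi_p^{f^*(\alpha)}\}$ for a (unique) function $f^*:\mathbb{F}_p^n\to\mathbb{F}_p$, called the dual of $f$. A bent $f$ is weakly regular if there is $\lambda\in\{\pm1,\pm\sqrt{-1}\}$ independent of $\alpha$ with $\mathcal{W}_f(\alpha)=\lambda p^{n/2}\xi_p^{f^*(\alpha)}$ for all $\alpha$; otherwise it is non-weakly regular. A bent $f$ is dual-bent if $f^*$ is also bent. For a bent function $f$: $B_+(f)=\{\alpha:\mathcal{W}_f(\alpha)=\mu p^{n/2}\xi_p^{f^*(\alpha)}\}$ and $B_-(f)=\{\alpha:\mathcal{W}_f(\alpha)=-\mu p^{n/2}\xi_p^{f^*(\alpha)}\}$.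 For $f$ dual-bent, $B_\pm(f^* )$ are defined by the same formulas applied to the bent function $f^*$. For dual-bent $f$ and $j\in\mathbb{F}_p$: $c_j(f)=\{x\in B_+(f^* ):f(x)=j\}$, $d_j(f)=\{x\in B_-(f^* ):f(x)=j\}$. $\mathcal{DBF}$ is the set of dual-bent functions $f:\mathbb{F}_p^n\to\mathbb{F}_p$ such that $f(0)=0$ and there is a positive integer $h$ with $\gcd(h-1,p-1)=1$ and $f(ax)=a^hf(x)$ for all $a\in\mathbb{F}_p^*$, $x\in\mathbb{F}_p^n$. A subspace $V$ of $\mathbb{F}_p^n$ is non-degenerate if $\{x\in V:x\cdot y=0\ \text{for all } y\in V\}=\{0\}$. Association schemes. A $d$-class association scheme on a nonempty finite set $X$ is a partition of $X\times X$ into relations $R_0,\dots,R_d$ such that $R_0=\{(x,x):x\in X\}$; for each $j$ the transpose $R_j^T$ equals some $R_{j'}$; and for all $u,v,w$ and $(x,y)\in R_w$ the number $|\{z\in X:(x,z)\in R_u,(z,y)\in R_v\}|$ depends only on $u,v,w$. It is symmetric if $R_j^T=R_j$ for all $j$. A partition $\{U_i\}_{i=0}^d$ of $\mathbb{F}_p^n$ (into nonempty sets) with $U_0=\{0\}$ induces a symmetric association scheme if the relations $R_i=\{(\alpha,\beta):\alpha-\beta\in U_i\}$, $0\le i\le d$, form a symmetric association scheme on $\mathbb{F}_p^n$. *)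

(* Defs.v *)
From HB Require Import structures.
From mathcomp Require Import all_boot all_order all_algebra.
From mathcomp Require Import complex.
From mathcomp Require Import reals trigo.

Set Implicit Arguments.
Unset Strict Implicit.
Unset Printing Implicit Defensive.

Import Order.TTheory GRing.Theory Num.Theory.
Local Open Scope ring_scope.

(* The complex numbers are R[i] for R : realType.  Everything below is meant
   for p prime, so that 'F_p really is the integers mod p. *)

Definition xi (R : realType) (p : nat) : R[i] :=
  Complex (cos (2 * pi / p%:R)) (sin (2 * pi / p%:R)).

Definition dotp {p n : nat} (x y : 'rV['F_p]_n) : 'F_p :=
  \sum_(i < n) x 0 i * y 0 i.

(* The exponent is the representative in {0, ..., p-1} of an element of 'F_p,
   which is harmless because xi has order p. *)
Definition walsh (R : realType) {p n : nat} (f : 'rV['F_p]_n -> 'F_p)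
    (a : 'rV['F_p]_n) : R[i] :=
  \sum_(x : 'rV['F_p]_n) xi R p ^+ (f x - dotp a x)%R.

(* p^(n/2), the nonnegative square root of p^n *)
Definition pn2 (R : realType) (p n : nat) : R[i] := sqrtC (p%:R ^+ n).

Definition bent (R : realType) {p n : nat} (f : 'rV['F_p]_n -> 'F_p) : Prop :=
  forall a, `|walsh R f a| = pn2 R p n.

Definition mu (R : realType) (p n : nat) : R[i] :=
  if (p ^ n %% 4 == 1)%N then 1 else 'i%C.

(* For bent f and p odd, exactly one j satisfies the condition; the default
   value 0 is only relevant to functions f that are not bent. *)
Definition dual (R : realType) {p n : nat} (f : 'rV['F_p]_n -> 'F_p)
    (a : 'rV['F_p]_n) : 'F_p :=
  odflt 0 [pick j : 'F_p |
    (walsh R f a == mu R p n * pn2 R p n * xi R p ^+ j) ||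
    (walsh R f a == - (mu R p n * pn2 R p n * xi R p ^+ j))].

Definition weakly_regular (R : realType) {p n : nat}
    (f : 'rV['F_p]_n -> 'F_p) : Prop :=
  bent R f /\
  exists2 lam : R[i], lam \in [:: 1; -1; 'i%C; - 'i%C] &
    forall a, walsh R f a = lam * pn2 R p n * xi R p ^+ dual R f a.

Definition non_weakly_regular_bent (R : realType) {p n : nat}
    (f : 'rV['F_p]_n -> 'F_p) : Prop :=
  bent R f /\ ~ weakly_regular R f.

Definition dual_bent (R : realType) {p n : nat}
    (f : 'rV['F_p]_n -> 'F_p) : Prop :=
  bent R f /\ bent R (dual R f).

Definition Bplus (R : realType) {p n : nat} (f : 'rV['F_p]_n -> 'F_p) :
    {set 'rV['F_p]_n} :=
  [set a | walsh R f a == mu R p n * pn2 R p n * xi R p ^+ dual R f a].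

Definition Bminus (R : realType) {p n : nat} (f : 'rV['F_p]_n -> 'F_p) :
    {set 'rV['F_p]_n} :=
  [set a | walsh R f a == - (mu R p n * pn2 R p n * xi R p ^+ dual R f a)].

Definition DBF (R : realType) {p n : nat} (f : 'rV['F_p]_n -> 'F_p) : Prop :=
  [/\ dual_bent R f, f 0 = 0 &
      exists h : nat, [/\ (0 < h)%N, coprime h.-1 p.-1 &
        forall (a : 'F_p) (x : 'rV['F_p]_n),
          a != 0 -> f (a *: x) = a ^+ h * f x]].

Definition cset (R : realType) {p n : nat} (f : 'rV['F_p]_n -> 'F_p)
    (j : 'F_p) : {set 'rV['F_p]_n} :=
  [set x in Bplus R (dual R f) | f x == j].

Definition dset (R : realType) {p n : nat} (f : 'rV['F_p]_n -> 'F_p)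
    (j : 'F_p) : {set 'rV['F_p]_n} :=
  [set x in Bminus R (dual R f) | f x == j].

Definition SQ (p : nat) : {set 'F_p} :=
  [set i | (i != 0) && [exists y : 'F_p, i == y ^+ 2]].

Definition NSQ (p : nat) : {set 'F_p} :=
  [set i | (i != 0) && ~~ [exists y : 'F_p, i == y ^+ 2]].

Definition Ppart (R : realType) {p n : nat} (f : 'rV['F_p]_n -> 'F_p) :
    {set {set 'rV['F_p]_n}} :=
  ([set [set 0]; cset R f 0 :\ 0; dset R f 0 :\ 0]
     :|: [set cset R f j | j : 'F_p & j != 0]
     :|: [set dset R f j | j : 'F_p & j != 0]) :\ set0.

Definition Dpart (R : realType) {p n : nat} (f : 'rV['F_p]_n -> 'F_p) :
    {set {set 'rV['F_p]_n}} :=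
  [set [set 0];
       cset R f 0 :\ 0;
       \bigcup_(i in SQ p) cset R f i;
       \bigcup_(i in NSQ p) cset R f i;
       dset R f 0 :\ 0;
       \bigcup_(i in SQ p) dset R f i;
       \bigcup_(i in NSQ p) dset R f i] :\ set0.

Definition nondegenerate {p n : nat} (V : {vspace 'rV['F_p]_n}) : Prop :=
  forall x, x \in V -> (forall y, y \in V -> dotp x y = 0) -> x = 0.

Definition nondegenerate_subspace {p n : nat} (S : {set 'rV['F_p]_n})
    (r : nat) : Prop :=
  exists V : {vspace 'rV['F_p]_n},
    [/\ S = [set x in V], \dim V = r & nondegenerate V].

Definition transpose {X : finType} (S : {set X * X}) : {set X * X} :=
  [set z | (z.2, z.1) \in S].

(* Nonemptiness of X is a consequence: R ord0 is a nonempty block. *)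
Definition assoc_scheme {X : finType} {d : nat}
    (R : 'I_d.+1 -> {set X * X}) : Prop :=
  [/\ injective R /\ partition [set R i | i : 'I_d.+1] [set: X * X],
      R ord0 = [set z | z.1 == z.2],
      forall j, exists j', transpose (R j) = R j' &
      forall u v w, exists c : nat, forall x y, (x, y) \in R w ->
        #|[set z | ((x, z) \in R u) && ((z, y) \in R v)]| = c].

Definition symmetric_assoc_scheme {X : finType} {d : nat}
    (R : 'I_d.+1 -> {set X * X}) : Prop :=
  assoc_scheme R /\ forall j, transpose (R j) = R j.

Definition induced_rel {V : finZmodType} (U : {set V}) : {set V * V} :=
  [set z | z.1 - z.2 \in U].

Definition induces_symmetric_scheme {V : finZmodType} (P : {set {set V}}) :
    Prop :=
  exists (d : nat) (U : 'I_d.+1 -> {set V}),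
    [/\ injective U /\ [set U i | i : 'I_d.+1] = P,
        partition P [set: V],
        U ord0 = [set 0] &
        symmetric_assoc_scheme (fun i => induced_rel (U i))].

(* Main.v *)
(* Write chi for an additive character of F_p and g for the dual of f.  Algebraic number
   theory in Z[z], z a primitive p-th root of unity, shows that for n odd the Walsh
   transform of a bent function is a sign times p ^ ((n - 1) / 2) times the quadratic
   Gauss sum times a value of chi; a parity argument gives that the dual of g is f.

   Let A be one of the two sign classes B_+(g), B_-(g), assumed to be a subspace of
   dimension r.  The sum of chi (f x - a.x) over A is supported on a set B of p ^ r
   elements, one of the two sign classes of f, where it is a constant times chi (g a);
   the pairs (A, f) and (B, g) play symmetric roles.  Put c_0 = {x in A | f x = 0}.
   If 2 r = n + 1, then a vanishing variance shows that the Fourier transform of B is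
   p ^ r on c_0 and 0 elsewhere, and symmetrically.  Hence the transforms of the blocks of
   the partition attached to (A, f) are constant on the blocks of the one attached to
   (B, g) and conversely, which makes both of them association schemes.  If 2 r > n + 1,
   let b_0 be the value of the transform of B on the nonzero elements of c_0, which is
   constant if they form a class of a scheme: their intersection number with themselves
   makes (p - 1) b_0 an integer, while summing the transform over c_0 gives
   b_0 = p ^ r (p ^ (n - r) - 1) / (p ^ (r - 1) - 1), a contradiction. *)

Require Import Defs.
From mathcomp Require Import all_boot all_order all_algebra all_solvable all_field.
From mathcomp Require Import complex.
From mathcomp Require Import reals trigo boolp.
From mathcomp Require Import ring lra zify.

Set Implicit Arguments.
Unset Strict Implicit.
Unset Printing Implicit Defensive.

Import Order.TTheory GRing.Theory Num.Theory.
Local Open Scope ring_scope.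

(** * Association schemes from partitions *)

Section InducedScheme.

Variables (V : finZmodType) (T : eqType) (lab : V -> T) (P : {set {set V}}).

Hypothesis P_fiber : forall U, U \in P -> exists x, U = [set y | lab y == lab x].
Hypothesis fiber_P : forall x, [set y | lab y == lab x] \in P.

Lemma fibers_partition : partition P [set: V].
Proof.
apply/and3P; split.
- apply/eqP/setP => x; rewrite inE; apply/bigcupP.
  by exists [set y | lab y == lab x]; rewrite ?fiber_P // inE.
- apply/trivIsetP => U W /P_fiber[x ->] /P_fiber[y ->] neq.
  rewrite -setI_eq0; apply: contraR neq => /set0Pn[z]; rewrite !inE.
  by case/andP=> /eqP <- /eqP <-.
- by apply/negP => /P_fiber[x] /setP/(_ x); rewrite !inE eqxx.
Qed.

Hypothesis P0 : [set 0] \in P.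
Hypothesis labN : forall x, lab (- x) = lab x.
Hypothesis count_fibers : forall u v x y, lab x = lab y ->
  #|[set w | (lab (x - w) == u) && (lab w == v)]| =
  #|[set w | (lab (y - w) == u) && (lab w == v)]|.

(** The relations are invariant under translation, so every intersection number can be read at a
    pair with second entry [0], where [count_fibers] makes it depend on the label only. Symmetry
    comes from [labN]. *)
Lemma fibers_symmetric_scheme : induces_symmetric_scheme P.
Proof.
(* [[set 0]] is moved to the front because the block of index [ord0] has to give the diagonal. *)
pose s := enum (P :\ [set 0]); pose d := size s.
pose U (i : 'I_d.+1) := nth set0 ([set 0] :: s) i.
have s_uniq : uniq ([set 0] :: s) by rewrite /= enum_uniq mem_enum in_setD1 eqxx.
have s_mem W : (W \in [set 0] :: s) = (W \in P).
  by rewrite inE mem_enum in_setD1; case: eqP => [->|].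
have U_inj : injective U.
  by move=> i j /eqP; rewrite nth_uniq //= ?ltn_ord // => /eqP/val_inj.
have U_P i : U i \in P by rewrite -s_mem mem_nth.
have P_U W : W \in P -> exists i, W = U i.
  rewrite -s_mem => Ws; have lt_W : (index W ([set 0%R] :: s) < d.+1)%N.
    by rewrite index_mem.
  by exists (Ordinal lt_W); rewrite /U nth_index.
have imU : [set U i | i : 'I_d.+1] = P.
  apply/setP => W; apply/imsetP/idP => [[i _ ->] //|/P_U[i ->]].
  by exists i.
have rel_inj : injective (@induced_rel V : {set V} -> {set V * V}).
  move=> W W' eW; apply/setP => x.
  have := in_set (fun z : V * V => z.1 - z.2 \in W) (x, 0).
  by rewrite -/(induced_rel W) eW inE /= subr0.
have symU i x : (- x \in U i) = (x \in U i).
  by have [y ->] := P_fiber (U_P i); rewrite !inE labN.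
have trU i : transpose (induced_rel (U i)) = induced_rel (U i).
  by apply/setP => -[x y]; rewrite !inE /= -symU opprB.
exists d, U; split=> //; first exact: fibers_partition.
split=> //; split=> [||i|u v w].
- split; first by move=> i j /rel_inj/U_inj.
  apply/and3P; split.
  + apply/eqP/setP => -[x y]; rewrite inE; apply/bigcupP.
    have [i Ui] := P_U _ (fiber_P (x - y)).
    by exists (induced_rel (U i)); [apply: imset_f | rewrite inE -Ui inE].
  + apply/trivIsetP => _ _ /imsetP[i _ ->] /imsetP[j _ ->] neq.
    rewrite -setI_eq0; apply: contraR neq => /set0Pn[[x y]]; rewrite !inE /=.
    have [a ->] := P_fiber (U_P i); have [b ->] := P_fiber (U_P j).
    by rewrite !inE => /andP[/eqP <- /eqP <-].
  + apply/negP => /imsetP[i _]; have [x Ui] := P_fiber (U_P i).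
    by move/setP/(_ (x, 0%R)); rewrite !inE /= subr0 Ui inE eqxx.
- by apply/setP => -[x y]; rewrite !inE /= subr_eq0.
- by exists i.
- have [a Uu] := P_fiber (U_P u); have [b Uv] := P_fiber (U_P v).
  have [e Uw] := P_fiber (U_P w).
  exists #|[set t | (lab (e - t) == lab a) && (lab t == lab b)]| => x y.
  rewrite inE /= Uw inE => /eqP /count_fibers <-.
  rewrite -[LHS](card_imset _ (addIr (- y))); apply: eq_card => t.
  rewrite inE; apply/imsetP/andP => [[t']|[t1 t2]].
    by rewrite !inE Uu Uv !inE /= => /andP[t1 t2] ->; rewrite opprB addrA subrK.
  exists (t + y); last by rewrite addrK.
  by rewrite !inE Uu Uv !inE /= addrK opprD addrA addrAC t1 t2.
Qed.

End InducedScheme.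

(** The intersection number of a block with itself, read at the pairs [(x, 0)], is all that the
    converse direction extracts from a scheme. *)
Lemma scheme_count (V : finZmodType) (P : {set {set V}}) (U : {set V}) :
  induces_symmetric_scheme P -> U \in P ->
  exists N, forall x, x \in U -> #|[set y | (x - y \in U) && (y \in U)]| = N.
Proof.
move=> [d [W [[_ <-] _ _ [[_ _ _ cnt] _]]]] /imsetP[i _ ->].
have [N eN] := cnt i i i; exists N => x xU.
rewrite -(eN x 0); last by rewrite inE /= subr0.
by apply: eq_card => y; rewrite !inE /= subr0.
Qed.

(** * Cyclotomic integers *)

Section CyclotomicIntegers.

Variables (C : numClosedFieldType) (p : nat) (z : C).
Hypotheses (p_pr : prime p) (p_odd : odd p) (z_prim : p.-primitive_root z).

Local Notation F := 'F_p.

Lemma big_Fp (T : Type) (op : T -> T -> T) idx (P : pred nat) (G : nat -> T) :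
  \big[op/idx]_(j : F | P j) G j = \big[op/idx]_(0 <= i < p | P i) G i.
Proof. by rewrite -(big_mkord P G) (Fp_cast p_pr). Qed.

Lemma ltn_Fp (j : F) : (j < p)%N.
Proof. by have := ltn_ord j; rewrite [X in (_ < X)%N](Fp_cast p_pr). Qed.

Definition chi (a : F) : C := z ^+ a.

Lemma chi_nat k : chi k%:R = z ^+ k.
Proof. by rewrite /chi (val_Fp_nat p_pr) (prim_expr_mod z_prim). Qed.

Lemma chi0 : chi 0 = 1.
Proof. by rewrite -(mulr0n 1) chi_nat expr0. Qed.

Lemma chiD a b : chi (a + b) = chi a * chi b.
Proof. by rewrite -(natr_Zp a) -(natr_Zp b) -natrD !chi_nat exprD. Qed.

Lemma chi_neq0 a : chi a != 0.
Proof.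
rewrite expf_neq0 //; apply: contra_eq_neq (prim_expr_order z_prim) => ->.
by rewrite expr0n -[p == 0]negbK -lt0n prime_gt0 // eq_sym oner_eq0.
Qed.

Lemma chiX a k : chi a ^+ k = chi (a *+ k).
Proof. by elim: k => [|k IH]; rewrite ?chi0 // exprS IH mulrS chiD. Qed.

Lemma chi_p a : chi a ^+ p = 1.
Proof. by rewrite exprAC (prim_expr_order z_prim) expr1n. Qed.

Lemma norm_chi a : `|chi a| = 1.
Proof.
apply/eqP; rewrite -(@pexpr_eq1 _ _ p) ?prime_gt0 //.
by rewrite -normrX chi_p normr1.
Qed.

Lemma chiN a : chi (- a) = (chi a)^-1.
Proof. by apply: (mulfI (chi_neq0 a)); rewrite -chiD subrr chi0 divff ?chi_neq0. Qed.

Lemma conj_chi a : (chi a)^* = chi (- a).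
Proof. by rewrite chiN invC_norm norm_chi expr1n invr1 mul1r. Qed.

Lemma chi_eq1 a : (chi a == 1) = (a == 0).
Proof.
rewrite /chi -(prim_order_dvd z_prim) -(inj_eq val_inj) /=.
by rewrite /dvdn modn_small ?ltn_Fp.
Qed.

Lemma chi_inj : injective chi.
Proof.
move=> a b eq_ab; apply/eqP; rewrite -subr_eq0 -chi_eq1 chiD chiN eq_ab.
by rewrite divff ?chi_neq0.
Qed.

(** Taking [p]-th powers kills the values of [chi] and, [p] being odd, keeps the sign. *)
Lemma sign_chi_inj (s t : bool) a b :
  (-1) ^+ s * chi a = (-1) ^+ t * chi b -> s = t /\ a = b.
Proof.
move=> eq_st; have eq_s : s = t.
  have /(congr1 (fun x => x ^+ p)) := eq_st.
  rewrite !exprMn !chi_p !mulr1 -!exprM ![(_ * p)%N]mulnC !exprM.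
  have -> : (-1 : C) ^+ p = -1 by rewrite -signr_odd p_odd.
  by move/eqP; rewrite (inj_eq (@signr_inj _)) => /eqP.
split=> //; apply: chi_inj; move: eq_st; rewrite eq_s.
by apply: mulfI; rewrite signr_eq0.
Qed.

Lemma sum_chi_mul (b : F) : \sum_t chi (t * b) = if b == 0 then p%:R else 0.
Proof.
case: eqP => [->|/eqP b0].
  under eq_bigr do rewrite mulr0 chi0.
  by rewrite sumr_const cardT -cardE card_Fp.
apply/eqP; have: (chi b - 1) * (\sum_t chi (t * b)) = 0.
  rewrite mulrBl mul1r big_distrr /=.
  rewrite [X in _ - X](reindex_inj (addrI 1)) /=.
  by apply/eqP; rewrite subr_eq0; apply/eqP/eq_bigr => t _; rewrite -chiD mulrDl mul1r.
by move/eqP; rewrite mulf_eq0 subr_eq0 chi_eq1 (negPf b0).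
Qed.

(* This is ((X + 1) ^ p - 1) / X. *)
Lemma irreducible_shifted_cyclotomic :
  irreducible_poly (\poly_(i < p) ('C(p, i.+1)%:R : int)).
Proof.
have p0 := prime_gt0 p_pr; have p1 := prime_gt1 p_pr.
have sz : size (\poly_(i < p) ('C(p, i.+1)%:R : int)) = p.
  by apply: size_poly_eq; rewrite prednK // binn.
apply: (eisenstein_crit p_pr); rewrite ?sz; first by rewrite neq_ltn p1 orbT.
- rewrite lead_coefE sz coef_poly prednK // leqnn binn.
  by rewrite dvdzE natz !absz_nat dvdn1 neq_ltn p1 orbT.
- by rewrite coef_poly p0 bin1 dvdzE natz !absz_nat gtnNdvd // ltn_Pmulr.
- move=> i lt_ip; rewrite coef_poly ifT; last by lia.
  by rewrite dvdzE natz !absz_nat prime_dvd_bin //; lia.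
Qed.

(* The [p]-th cyclotomic polynomial has degree [p - 1] and is irreducible, so
   it generates all the rational relations between the powers of [z]. *)
Lemma chi_lin_indep (a : F -> int) :
  \sum_j (a j)%:~R * chi j = 0 -> forall j, a j = a 0.
Proof.
move=> a0; have p0 := prime_gt0 p_pr; have p1 := prime_gt1 p_pr.
pose q : {poly int} := \poly_(i < p) a i%:R.
pose E : {poly int} := \poly_(i < p) 'C(p, i.+1)%:R.
have XE : 'X * E = ('X + 1) ^+ p - 1.
  rewrite addrC exprD1n big_ord_recl expr0 bin0 mulr1n addrA addNr add0r.
  rewrite /E poly_def big_distrr /=; apply: eq_bigr => i _.
  by rewrite -mul_polyC polyC_natr exprS -mulr_natr; ring.
have qz : (map_poly intr q).[z] = 0 :> C.
  rewrite -a0 (eq_bigr (fun j : F => (a (j : nat)%:R)%:~R * z ^+ j)); last first.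
    by move=> j _; rewrite natr_Zp.
  rewrite (@big_Fp _ _ _ xpredT (fun i => (a i%:R)%:~R * z ^+ i)) big_mkord.
  rewrite /q poly_def rmorph_sum horner_sum; apply: eq_bigr => i _.
  by rewrite /= map_polyZ map_polyXn hornerZ hornerXn.
pose toQ := map_poly (intr : int -> rat).
(* Substituting X + 1 turns the root [z] into [z - 1], a root of the Eisenstein polynomial [E]. *)
pose qs := toQ q \Po ('X + 1%:P).
have ratrK (r : {poly int}) : map_poly ratr (toQ r) = map_poly intr r :> {poly C}.
  by rewrite /toQ -map_poly_comp; apply: eq_map_poly => x /=; rewrite ratr_int.
have Ez : root (map_poly ratr (toQ E)) (z - 1).
  rewrite ratrK /root; have z1 : z - 1 != 0.
    rewrite subr_eq0 -[z]expr1 -(prim_order_dvd z_prim) dvdn1.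
    by rewrite neq_ltn p1 orbT.
  apply/eqP/(mulfI z1); rewrite mulr0.
  have /(congr1 (fun r => (map_poly intr r).[z - 1])) := XE.
  rewrite !(rmorphM, rmorphB, rmorphXn, rmorphD, rmorph1) /= map_polyX !hornerE.
  by rewrite subrK (prim_expr_order z_prim) subrr.
have qsz : (map_poly ratr qs).[z - 1] = 0.
  rewrite /qs map_comp_poly horner_comp rmorphD /= map_polyX map_polyC /= rmorph1.
  rewrite !hornerE.
  by rewrite subrK ratrK.
have Eirr : irreducible_poly (toQ E).
  exact/irreducible_rat_int/irreducible_shifted_cyclotomic.
have Edvd : toQ E %| qs.
  rewrite -[_ %| _]negbK -irreducible_poly_coprime //; apply/negP => co.
  have /coprimep_root/(_ Ez) :
      coprimep (map_poly ratr (toQ E)) (map_poly ratr qs : {poly C}).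
    by rewrite coprimep_map.
  by rewrite qsz eqxx.
have sQ (r : {poly int}) : size (toQ r) = size r.
  by rewrite size_map_inj_poly ?rmorph0 //; apply: intr_inj.
have [c qsE] : exists c, qs = c *: toQ E.
  have [u qsE] := dvdpP _ _ Edvd; have [u0|u0] := eqVneq u 0.
    by exists 0; rewrite qsE u0 mul0r scale0r.
  have E0 : toQ E != 0 by rewrite irredp_neq0.
  have : (size qs <= p)%N.
    by rewrite size_comp_poly2 ?size_XaddC // sQ size_poly.
  rewrite qsE size_mul // sQ size_poly_eq ?prednK ?binn // => szu.
  have /size1_polyC uE : (size u <= 1)%N.
    by rewrite -(leq_add2r p); apply: leq_trans (leqSpred _) _; rewrite add1n ltnS.
  by exists u`_0; rewrite uE mul_polyC coefC.
(* Substituting back, [q] is [c] times 1 + X + ... + X ^ (p - 1). Multiplied by X - 1, this says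
   that consecutive coefficients of [q] agree. *)
have qE : ('X - 1) * toQ q = c *: ('X ^+ p - 1).
  rewrite -(comp_polyXaddC_K (toQ q) 1) -/qs qsE comp_polyZ -scalerAr.
  congr (_ *: _); have /(congr1 toQ) := XE.
  rewrite [LHS]rmorphM [RHS]rmorphB [X in _ = X - _]rmorphXn [X in _ = X ^+ _ - _]rmorphD.
  rewrite !rmorph1 /= map_polyX => /(congr1 (fun r => r \Po ('X - 1%:P))).
  rewrite comp_polyM comp_polyX comp_polyB [X in _ = X - _]rmorphXn /=.
  rewrite comp_polyD comp_polyX.
  by rewrite -polyC1 !comp_polyC subrK.
have step i : (i.+1 < p)%N -> q`_i = q`_i.+1.
  move=> lt_ip; have /(congr1 (fun r : {poly rat} => r`_i.+1)) := qE.
  rewrite mulrBl mul1r coefB coefXM /= coefZ coefB coefXn coef1 /=.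
  rewrite (ltn_eqF lt_ip) subr0 mulr0 !coef_map /= => /eqP.
  by rewrite subr_eq0 => /eqP/intr_inj.
have const i : (i < p)%N -> q`_i = q`_0.
  by elim: i => // i IH lt_ip; rewrite -step // IH // ltnW.
move=> j; have := const j (ltn_Fp j).
by rewrite !coef_poly ltn_Fp p0 natr_Zp.
Qed.

(** This stands for the automorphism sending z to z ^ t: a relation has constant coefficients, so
    permuting the powers of [z] preserves it. *)
Lemma chi_galois (a : F -> int) (t : F) : t != 0 ->
  \sum_j (a j)%:~R * chi j = 0 -> \sum_j (a j)%:~R * chi (t * j) = 0.
Proof.
move=> t0 /chi_lin_indep a_const.
under eq_bigr do rewrite a_const mulrC (mulrC t).
by rewrite -mulr_suml sum_chi_mul (negPf t0) mul0r.
Qed.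

(** Membership in Z[z]. All [p] powers of [z] are used, which keeps the indexing by [F] uniform at
    the price of non-unique coefficients. *)
Definition cycint (x : C) := exists a : F -> int, x = \sum_j (a j)%:~R * chi j.

Lemma cycint_chi j : cycint (chi j).
Proof.
exists (fun k => (k == j)%:R); rewrite (bigD1 j) //= eqxx mul1r big1 ?addr0 //.
by move=> k /negPf->; rewrite mul0r.
Qed.

Lemma cycint0 : cycint 0.
Proof. by exists (fun=> 0); rewrite big1 // => j _; rewrite mul0r. Qed.

Lemma cycintD x y : cycint x -> cycint y -> cycint (x + y).
Proof.
move=> [a ->] [b ->]; exists (fun j => a j + b j); rewrite -big_split /=.
by apply: eq_bigr => j _; rewrite intrD mulrDl.
Qed.

Lemma cycintZ (s : int) x : cycint x -> cycint (s%:~R * x).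
Proof.
move=> [a ->]; exists (fun j => s * a j); rewrite big_distrr /=.
by apply: eq_bigr => j _; rewrite intrM mulrA.
Qed.

Lemma cycint_int (s : int) : cycint s%:~R.
Proof. by rewrite -[s%:~R]mulr1 -chi0; apply/cycintZ/cycint_chi. Qed.

Lemma cycintN x : cycint x -> cycint (- x).
Proof. by move=> /(cycintZ (-1)); rewrite mulN1r. Qed.

Lemma cycint_sum (I : Type) (r : seq I) (P : pred I) (G : I -> C) :
  (forall i, cycint (G i)) -> cycint (\sum_(i <- r | P i) G i).
Proof. by move=> Gi; apply: big_ind => //; [apply: cycint0 | apply: cycintD]. Qed.

Lemma chi_conv (a b : F -> int) :
  (\sum_j (a j)%:~R * chi j) * (\sum_j (b j)%:~R * chi j) =
  \sum_l (\sum_j a j * b (l - j))%:~R * chi l.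
Proof.
rewrite big_distrl /=.
under [RHS]eq_bigr do rewrite rmorph_sum big_distrl /=.
rewrite exchange_big /=; apply: eq_bigr => j _.
rewrite big_distrr (reindex_inj (addIr (- j))) /=; apply: eq_bigr => l _.
by rewrite intrM mulrACA -chiD [j + _]addrC subrK.
Qed.

Lemma cycintM x y : cycint x -> cycint y -> cycint (x * y).
Proof.
move=> [a ->] [b ->]; exists (fun l => \sum_j a j * b (l - j)).
exact: chi_conv.
Qed.

Lemma cycintX x k : cycint x -> cycint (x ^+ k).
Proof.
move=> cx; elim: k => [|k IH]; first exact: (cycint_int 1).
by rewrite exprS; apply: cycintM.
Qed.

Lemma conj_chi_sum (a : F -> int) :
  (\sum_j (a j)%:~R * chi j)^* = \sum_j (a (- j))%:~R * chi j.
Proof.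
rewrite rmorph_sum (reindex_inj oppr_inj) /=; apply: eq_bigr => j _.
by rewrite rmorphM /= rmorph_int conj_chi opprK.
Qed.

Lemma cycint_conj x : cycint x -> cycint x^*.
Proof. by move=> [a ->]; exists (fun j => a (- j)); rewrite conj_chi_sum. Qed.

(** * Divisibility by the prime 1 - z above p *)

Let lam : C := 1 - chi 1.

(** [chi b] is the power of [chi a] with exponent [b / a], so the quotient is a geometric sum. *)
Let one_sub_chi (a b : F) : a != 0 ->
  exists2 w, cycint w & 1 - chi b = (1 - chi a) * w.
Proof.
move=> a0; exists (\sum_(i < (b / a : F)) chi a ^+ i).
  by apply: cycint_sum => i; apply/cycintX/cycint_chi.
rewrite -opprB -[1 - _]opprB mulNr -subrX1 chiX.
by rewrite -mulr_natr natr_Zp mulrC divfK.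
Qed.

(** Each [chi j] is congruent to 1 modulo [lam], so an element is congruent to the sum of its
    coefficients. *)
Let cycint_mod_lam x : cycint x ->
  exists s : int, exists2 w, cycint w & x = s%:~R + lam * w.
Proof.
move=> [a ->]; exists (\sum_j a j); rewrite rmorph_sum /=.
pose P y v := exists2 w, cycint w & v = y + lam * w.
apply: (big_ind2 P) => [|y v y' v' [w cw ->] [w' cw' ->]|j _].
- by exists 0; [exact: cycint0 | rewrite mulr0 addr0].
- by exists (w + w'); [exact: cycintD | ring].
have [w cw e] := one_sub_chi j (oner_neq0 _ : (1 : F) != 0).
exists (- (a j)%:~R * w); first by apply: cycintM => //; apply/cycintN/cycint_int.
by rewrite -[chi j](subKr 1) e /lam; ring.
Qed.

(** Comparing coefficients gives a relation, whose coefficients are all equal; summed over [j], the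
    differences [a j - a (j - 1)] cancel and [s] is [p] times the common value. *)
Let int_mod_lam (s : int) w : cycint w -> s%:~R = lam * w -> (p %| s)%Z.
Proof.
move=> [a ->] e.
have: \sum_j (s *+ (j == 0) - (a j - a (j - 1)))%:~R * chi j = 0.
  under eq_bigr do rewrite rmorphB mulrBl.
  rewrite sumrB /= (bigD1 0) //= big1 ?addr0 => [|j /negPf->]; last first.
    by rewrite mulr0n mul0r.
  rewrite ?eqxx ?mulr1n chi0 mulr1 e mulrBl mul1r.
  under [X in _ - X]eq_bigr do rewrite rmorphB mulrBl.
  rewrite sumrB [X in _ - (_ - X)](reindex_inj (addIr 1)) /=.
  under [X in _ - (_ - X)]eq_bigr do rewrite addrK chiD mulrA mulrC.
  by rewrite -mulr_sumr subrr.
move/chi_lin_indep => cst; pose c := s *+ (0 == 0 :> F) - (a 0 - a (0 - 1)).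
have : \sum_(j : F) (s *+ (j == 0) - (a j - a (j - 1))) = c *+ p.
  by rewrite (eq_bigr (fun=> c)) ?sumr_const ?cardT -?cardE ?card_Fp.
rewrite !sumrB [X in _ - (_ - X)](reindex_inj (addIr 1)) /=.
under [X in _ - (_ - X)]eq_bigr do rewrite addrK.
rewrite subrr subr0 (bigD1 0) //= big1 ?addr0 => [|j /negPf->] //.
by rewrite mulr1n => ->; rewrite -mulr_natr natz dvdz_mull.
Qed.

(** Evaluating (X ^ p - 1) / (X - 1) at 1 writes [p] as the product of the [1 - chi j], and each
    factor is an associate of [lam]. *)
Let p_lam : exists u u', [/\ cycint u, cycint u',
  p%:R = lam ^+ p.-1 * u & lam ^+ p.-1 = p%:R * u'].
Proof.
have p0 := prime_gt0 p_pr; have p1 := prime_gt1 p_pr.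
have pE : p%:R = \prod_(j : F | j != 0) (1 - chi j).
  rewrite (@big_Fp _ _ _ (fun i => i != 0) (fun i => 1 - z ^+ i)).
  rewrite big_mkcond big_ltn //= mul1r.
  have := factor_Xn_sub_1 z_prim; rewrite big_ltn // expr0 subrX1 polyC1 => /mulfI.
  rewrite -{1}polyC1 polyXsubC_eq0 => /(_ isT)/(congr1 (horner^~ 1)).
  rewrite horner_prod horner_sum => e.
  under [RHS]eq_big_nat => i /andP[i0 _] do rewrite -lt0n i0 -(hornerXsubC _ 1).
  rewrite e; under eq_bigr do rewrite hornerXn expr1n.
  by rewrite sumr_const card_ord.
have cardF : #|[pred j : F | j != 0]| = p.-1.
  by have := cardC1 (0 : F); rewrite card_Fp.
have one0 : (1 : F) != 0 := oner_neq0 _.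
have u1 j : exists w, cycint w /\ 1 - chi j = lam * w.
  by have [w cw e] := one_sub_chi j one0; exists w.
have u2 (j : F) : j != 0 -> exists w, cycint w /\ lam = (1 - chi j) * w.
  by move=> j0; have [w cw e] := one_sub_chi 1 j0; exists w.
have prodM (x y : F -> C) :
    (forall j, j != 0 -> exists w, cycint w /\ x j = y j * w) ->
  exists w, cycint w /\ \prod_(j | j != 0) x j = \prod_(j | j != 0) y j * w.
  pose P x' y' := exists w, cycint w /\ x' = y' * w.
  apply: (big_ind2 P) => [|x1 y1 x2 y2 [v [cv ->]] [v' [cv' ->]]].
    by exists 1; split; [exact: (cycint_int 1) | rewrite mulr1].
  by exists (v * v'); split; [exact: cycintM | ring].
have [u [cu pu]] := prodM _ _ (fun j _ => u1 j).
have [u' [cu' pu']] := prodM _ _ u2.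
rewrite pE; move: pu pu'; rewrite prodr_const cardF => pu pu'.
by exists u, u'.
Qed.

Let conj_lam : lam^* = - chi (- 1) * lam.
Proof.
rewrite /lam rmorphB rmorph1 /= conj_chi mulrBr mulr1 mulNr -chiD addNr chi0.
by rewrite opprK addrC.
Qed.

Let lam_neq0 : lam != 0.
Proof. by rewrite subr_eq0 eq_sym chi_eq1 oner_neq0. Qed.

(* The prime [lam] above [p] is fixed by complex conjugation up to a unit. *)
Let lam_dvd_norm x w : cycint x -> cycint w -> x * x^* = lam * w ->
  exists2 y, cycint y & x = lam * y.
Proof.
move=> cx cw e; have [s [v cv xE]] := cycint_mod_lam cx.
have cvc := cycint_conj cv.
have [k sE] : exists k, s = p%:Z * k.
  suff: (p %| s)%Z by case/dvdzP => k ->; exists k; rewrite mulrC.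
  have: (p %| s * s)%Z.
    apply: (@int_mod_lam _ (w - s%:~R * v + s%:~R * chi (- 1) * v^*
      + chi (- 1) * lam * v * v^*)).
      do ![apply: cycintD]; do ?[apply: cycintN]; do ?[apply: cycintM] => //;
        try exact: cycint_int; try exact: cycint_chi.
      by apply: cycintD; [exact: (cycint_int 1) | apply/cycintN/cycint_chi].
    move: e; rewrite xE rmorphD rmorphM /= rmorph_int conj_lam intrM => e.
    rewrite !(mulrDr lam) -e; ring.
  by rewrite !dvdzE abszM Euclid_dvdM // orbb.
have [u [u' [cu cu' pu _]]] := p_lam.
exists (lam ^+ p.-2 * u * k%:~R + v).
  apply: cycintD => //; do ![apply: cycintM] => //; last exact: cycint_int.
  apply: cycintX; apply: cycintD; [exact: (cycint_int 1) | apply/cycintN/cycint_chi].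
rewrite xE sE intrM [p%:~R]pu; have -> : p.-1 = p.-2.+1 by have := prime_gt1 p_pr; lia.
by rewrite exprS; ring.
Qed.

Let lam_dvd_normX k x w : cycint x -> cycint w ->
  x * x^* = lam ^+ k * (lam^*) ^+ k * w -> exists2 y, cycint y & x = lam ^+ k * y.
Proof.
elim: k x => [|k IH] x cx cw e; first by exists x; rewrite ?mul1r.
have clam : cycint lam.
  by apply: cycintD; [exact: (cycint_int 1) | apply/cycintN/cycint_chi].
have [||y cy xE] := @lam_dvd_norm x (lam ^+ k * (lam^*) ^+ k.+1 * w) cx.
- by do ![apply: cycintM] => //; apply: cycintX => //; apply: cycint_conj.
- by rewrite e exprS; ring.
have [|v cv yE] := IH y cy cw; last by exists v => //; rewrite xE yE exprS mulrA.
have lc0 : lam^* != 0 by rewrite conjC_eq0.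
apply: (mulfI lam_neq0); apply: (mulfI lc0).
move: e; rewrite xE rmorphM !exprS => e.
by transitivity (lam * y * (lam^* * y^*)); [ring | rewrite e; ring].
Qed.

(** Up to associates [p] is [lam ^+ p.-1], so the powers of [lam] that [lam_dvd_normX] extracts from
    [x] amount to p ^ K. *)
Lemma cycint_dvd_norm K x : cycint x -> x * x^* = p%:R ^+ (K + K) ->
  exists2 y, cycint y & x = p%:R ^+ K * y.
Proof.
have [u [u' [cu cu' pu pu']]] := p_lam.
move=> cx e; have [||y cy ->] := @lam_dvd_normX (p.-1 * K) x ((u * u^*) ^+ K) cx.
- by apply/cycintX/cycintM => //; apply: cycint_conj.
- rewrite e (_ : p%:R ^+ (K + K) = (p%:R * (p%:R)^*) ^+ K); last first.
    by rewrite conjC_nat exprMn exprD.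
  rewrite pu rmorphM rmorphXn /= !exprM -!exprMn; congr (_ ^+ K).
  by rewrite exprMn mulrACA.
exists (u' ^+ K * y); first by apply: cycintM => //; apply: cycintX.
by rewrite exprM pu' exprMn mulrA.
Qed.

(* Coefficients are only determined up to a common constant, so the sum of the
   coefficients of a unit of norm 1 can be shifted to +1 or -1; the sum of their
   squares is then 1. *)
Let sum_coef_norm1 (a : F -> int) :
  (\sum_j (a j)%:~R * chi j) * (\sum_j (a j)%:~R * chi j)^* = 1 ->
  (\sum_j a j) ^+ 2 = p%:Z * (\sum_j a j ^+ 2 - 1) + 1.
Proof.
rewrite conj_chi_sum chi_conv => e.
pose A l := \sum_j a j * a (- (l - j)).
have: \sum_l (A l - (l == 0)%:R)%:~R * chi l = 0.
  under eq_bigr do rewrite rmorphB mulrBl.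
  rewrite sumrB e (bigD1 0) //= big1 ?addr0 => [|j /negPf->]; last first.
    by rewrite mul0r.
  by rewrite chi0 mulr1 subrr.
move/chi_lin_indep => cst.
have AE l : A l = (\sum_j a j ^+ 2 - 1) + (l == 0)%:R.
  have := cst l; rewrite eqxx /A => /eqP; rewrite subr_eq => /eqP ->.
  by congr (_ - _ + _); apply: eq_bigr => j _; rewrite sub0r opprK expr2.
have: \sum_l A l = (\sum_j a j) ^+ 2.
  rewrite exchange_big expr2 big_distrl /=; apply: eq_bigr => j _.
  rewrite -mulr_sumr; congr (_ * _); rewrite [RHS](reindex_inj (addrI j)) /=.
  by rewrite (reindex_inj oppr_inj) /=; apply: eq_bigr => l _; rewrite opprB opprK.
under eq_bigr do rewrite AE.
rewrite big_split /= sumr_const cardT -cardE card_Fp // => <-; congr (_ + _).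
  by rewrite -mulr_natl natz.
by rewrite (bigD1 0) //= big1 ?addr0 // => j /negPf->.
Qed.

(** A case of Kronecker's theorem on roots of unity: once the coefficients are shifted, they are
    integers whose squares add up to 1, so a single one is nonzero. *)
Lemma cycint_norm1 x : cycint x -> x * x^* = 1 ->
  exists (s : bool) j, x = (-1) ^+ s * chi j.
Proof.
move=> [a xE] nx; have := nx; rewrite xE => /sum_coef_norm1 e.
have [s [t St]] : exists (s : bool) t, \sum_j a j = (-1) ^+ s + p%:Z * t.
  have: (p %| (\sum_j a j - 1) * (\sum_j a j + 1))%Z.
    rewrite -subr_sqr expr1n e addrK; exact: dvdz_mulr.
  rewrite dvdzE abszM Euclid_dvdM // -!(dvdzE p%:Z).
  case/orP => /dvdzP[t /eqP]; [exists false, t | exists true, t]; apply/eqP.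
    by rewrite expr0 addrC -subr_eq mulrC.
  by rewrite expr1 addrC -subr_eq opprK mulrC.
pose b j := a j - t.
have xb : x = \sum_j (b j)%:~R * chi j.
  under eq_bigr do rewrite rmorphB mulrBl.
  rewrite sumrB -xE -mulr_sumr; have := sum_chi_mul 1; rewrite oner_eq0.
  by under eq_bigr do rewrite mulr1; move=> ->; rewrite mulr0 subr0.
have Sb : \sum_j b j = (-1) ^+ s.
  rewrite sumrB St sumr_const cardT -cardE card_Fp // -mulr_natl natz; ring.
have := nx; rewrite xb => /sum_coef_norm1; rewrite Sb sqrr_sign.
rewrite -{1}[1]add0r => /addIr/esym/eqP; rewrite mulf_eq0 -(natz p).
rewrite pnatr_eq0 -[p == 0]negbK -lt0n prime_gt0 //= subr_eq0 => /eqP sq1.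
have [j bj0] : exists j, b j != 0.
  apply/existsP; rewrite -[[exists j, _]]negbK negb_exists; apply/negP => /forallP b0.
  move: Sb; rewrite big1 => [/eqP|j _]; last by apply/eqP; rewrite -[_ == _]negbK b0.
  by rewrite eq_sym signr_eq0.
have bk0 k : k != j -> b k = 0.
  move=> kj; apply/eqP; rewrite -sqrf_eq0 eq_le sqr_ge0 andbT.
  move: sq1; rewrite (bigD1 j) //= (bigD1 k) //= => sq1.
  have : 1 <= b j ^+ 2 by rewrite -gtz0_ge1 exprn_even_gt0 //= bj0.
  have : 0 <= \sum_(i | (i != j) && (i != k)) b i ^+ 2.
    by apply: sumr_ge0 => i _; apply: sqr_ge0.
  by lra.
exists s, j; rewrite -xE xb (bigD1 j) //= big1 ?addr0 => [|k /bk0->]; last first.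
  by rewrite mul0r.
move: Sb; rewrite (bigD1 j) //= big1 ?addr0 => [->|k /bk0->//].
by rewrite rmorph_sign.
Qed.

(** * Quadratic Gauss sums *)

Lemma Fp_expf_pred (a : F) : a != 0 -> a ^+ p.-1 = 1.
Proof.
move=> a0; apply: (mulfI a0); rewrite mulr1 -exprS prednK ?prime_gt0 //.
by have := expf_card a; rewrite card_Fp.
Qed.

Lemma Fp_prim_root : exists g : F, p.-1.-primitive_root g.
Proof.
have p1 := prime_gt1 p_pr.
have /hasP[g _ g_prim] : has p.-1.-primitive_root (enum [pred x : F | x != 0]).
  apply: has_prim_root; rewrite ?enum_uniq //; first by rewrite -ltnS prednK // ltnW.
    apply/allP => x; rewrite mem_enum inE => x0.
    by rewrite unity_rootE Fp_expf_pred.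
  by have := cardC1 (0 : F); rewrite card_Fp // cardE => <-.
by exists g.
Qed.

Let p_half : p.-1 = (p./2 * 2)%N.
Proof. by have := odd_double_half p; rewrite p_odd muln2 => /(congr1 predn). Qed.

Lemma Fp_two_neq0 : (2 : F) != 0.
Proof.
rewrite -(dvdn_pcharf (pchar_Fp p_pr)) gtnNdvd //.
by case: (p) p_odd (prime_gt1 p_pr) => [|[|[]]].
Qed.

Lemma Fp_N1_neq1 : (-1 : F) != 1.
Proof.
by rewrite -subr_eq0 -opprD oppr_eq0 -[1 + 1]/(2%:R) Fp_two_neq0.
Qed.

(* The quadratic character, given by Euler's criterion. *)
Definition eta (a : F) : int :=
  if a == 0 then 0 else if a ^+ p./2 == 1 then 1 else -1.

Lemma eta0 : eta 0 = 0.
Proof. by rewrite /eta eqxx. Qed.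

Let Euler_sign (a : F) : a != 0 -> a ^+ p./2 = 1 \/ a ^+ p./2 = -1.
Proof.
move=> a0; have /eqP : (a ^+ p./2) ^+ 2 = 1 by rewrite -exprM -p_half Fp_expf_pred.
by rewrite sqrf_eq1 => /orP[]/eqP ->; [left | right].
Qed.

Lemma eta_sign a : a != 0 ->
  exists s : bool, eta a = (-1) ^+ s :> int /\ a ^+ p./2 = (-1) ^+ s :> F.
Proof.
move=> a0; rewrite /eta (negPf a0); have [->|->] := Euler_sign a0.
  by exists false; rewrite eqxx.
by exists true; rewrite (negPf Fp_N1_neq1).
Qed.

Lemma etaM a b : eta (a * b) = eta a * eta b.
Proof.
have [->|a0] := eqVneq a 0; first by rewrite mul0r eta0 mul0r.
have [->|b0] := eqVneq b 0; first by rewrite mulr0 eta0 mulr0.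
have [s [-> sE]] := eta_sign a0; have [t [-> tE]] := eta_sign b0.
rewrite /eta mulf_eq0 (negPf a0) (negPf b0) exprMn sE tE -!signr_addb.
by case: (s (+) t); rewrite ?eqxx ?(negPf Fp_N1_neq1).
Qed.

Lemma eta_sqr a : a != 0 -> eta a ^+ 2 = 1.
Proof. by move=> a0; have [s [-> _]] := eta_sign a0; rewrite sqrr_sign. Qed.

Lemma eta1 : eta 1 = 1.
Proof. by rewrite /eta oner_eq0 expr1n eqxx. Qed.

Lemma eta_mul_sqr a t : t != 0 -> eta (a * t ^+ 2) = eta a.
Proof. by move=> t0; rewrite !etaM -expr2 eta_sqr ?mulr1. Qed.

Lemma etaN1 : eta (- 1)%R = ((-1) ^+ p./2)%R :> int.
Proof.
rewrite /eta oppr_eq0 oner_eq0 -[RHS]signr_odd.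
have -> : (-1 : F) ^+ p./2 = (-1) ^+ odd p./2 by rewrite signr_odd.
by case: odd; rewrite ?expr1 ?(negPf Fp_N1_neq1) ?eqxx.
Qed.

Lemma sum_eta : \sum_a eta a = 0.
Proof.
have [g g_prim] := Fp_prim_root; have p1 := prime_gt1 p_pr.
have g0 : g != 0.
  apply: contra_eq_neq (prim_expr_order g_prim) => ->.
  by rewrite expr0n -[_.-1 == 0]negbK -lt0n -ltnS prednK ?p1 1?ltnW // eq_sym oner_eq0.
have eg : eta g = -1.
  rewrite /eta (negPf g0) -(prim_order_dvd g_prim) gtnNdvd //.
    by case: (p) p_odd p1 => [|[|[]]].
  by have := p_half; have := p1; lia.
have : \sum_a eta a = - \sum_a eta a.
  rewrite -mulN1r mulr_sumr {1}(reindex_inj (mulfI g0)) /=.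
  by apply: eq_bigr => a _; rewrite etaM eg.
by lia.
Qed.

(** Two nonsquares are both odd powers of a generator, so [a * b] is a square, and [b] is [a] times
    the square of its root divided by [a]. *)
Lemma Fp_sqr_classes (a b : F) : a != 0 -> b != 0 ->
  [exists y, a == y ^+ 2] = [exists y, b == y ^+ 2] ->
  exists2 s, s != 0 & b = a * s ^+ 2.
Proof.
move=> a0 b0.
have [/existsP[x /eqP aE] /esym/existsP[y /eqP bE]|nsa /esym/negbT nsb] :=
  boolP [exists y, a == y ^+ 2].
  exists (y / x); last by rewrite bE aE exprMn exprVn mulrC divfK // -aE.
  by rewrite mulf_neq0 ?invr_eq0 //; [rewrite -sqrf_eq0 -bE | rewrite -sqrf_eq0 -aE].
have [g g_prim] := Fp_prim_root.
have odd_exp c : c != 0 -> ~~ [exists y, c == y ^+ 2] -> exists2 i, odd i & c = g ^+ i.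
  move=> c0 nsc; have [i cE] := prim_rootP g_prim (Fp_expf_pred c0).
  exists i => //; apply: contraR nsc => ev_i; apply/existsP; exists (g ^+ i./2).
  by rewrite cE -exprM muln2 halfK (negPf ev_i) subn0.
have [i oi aE] := odd_exp a a0 nsa; have [j oj bE] := odd_exp b b0 nsb.
have abE : a * b = (g ^+ (i + j)./2) ^+ 2.
  by rewrite aE bE -exprD -exprM muln2 halfK oddD oi oj subn0.
exists (g ^+ (i + j)./2 / a).
  by rewrite mulf_neq0 ?invr_eq0 // -sqrf_eq0 -abE mulf_neq0.
by rewrite exprMn -abE; field.
Qed.

Definition gauss : C := \sum_j (eta j)%:~R * chi j.

Lemma gauss_mul t : \sum_j (eta j)%:~R * chi (t * j) = (eta t)%:~R * gauss.
Proof.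
have [->|t0] := eqVneq t 0.
  under eq_bigr do rewrite mul0r chi0 mulr1.
  by rewrite -rmorph_sum sum_eta eta0 mul0r.
rewrite /gauss [X in _ * X](reindex_inj (mulfI t0)) mulr_sumr /=.
apply: eq_bigr => j _; rewrite etaM mulrA -intrM mulrA -expr2.
by rewrite eta_sqr ?mul1r.
Qed.

Lemma conj_gauss : gauss^* = (eta (- 1))%:~R * gauss.
Proof.
rewrite -gauss_mul rmorph_sum; apply: eq_bigr => j _.
by rewrite rmorphM /= rmorph_int conj_chi mulN1r.
Qed.

Let sum_eta_sqr : \sum_t (eta t)%:~R ^+ 2 = p.-1%:R :> C.
Proof.
rewrite (bigD1 0) //= eta0 expr0n add0r (eq_bigr (fun=> 1)) => [|t t0]; last first.
  by rewrite -rmorphXn eta_sqr.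
by rewrite sumr_const; have := cardC1 (0 : F); rewrite card_Fp // => ->.
Qed.

(** The squared moduli of the sums in [gauss_mul] are added over [t] in two ways: each nonzero [t]
    contributes [gauss * gauss^*], while by orthogonality only the diagonal terms survive. *)
Lemma gauss_norm : gauss * gauss^* = p%:R.
Proof.
have p1C : p.-1%:R != 0 :> C.
  by rewrite pnatr_eq0 -lt0n -ltnS prednK ?prime_gt1 ?prime_gt0.
apply: (mulfI p1C); rewrite -[in LHS]sum_eta_sqr mulr_suml.
transitivity (\sum_t (\sum_j (eta j)%:~R * chi (t * j)) *
                     (\sum_k (eta k)%:~R * chi (- (t * k)))).
  apply: eq_bigr => t _; rewrite gauss_mul.
  under [in RHS]eq_bigr do rewrite -mulNr.
  rewrite gauss_mul conj_gauss -[- t]mulN1r etaM intrM; ring.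
under eq_bigr do rewrite big_distrl /=.
rewrite exchange_big -sum_eta_sqr mulr_suml /=; apply: eq_bigr => j _.
under eq_bigr do rewrite big_distrr /=.
rewrite exchange_big /= (bigD1 j) //= [X in _ + X]big1 => [|k kj].
  rewrite addr0 -[in RHS](card_Fp p_pr) -sumr_const mulr_sumr.
  apply: eq_bigr => t _.
  by rewrite mulrACA -expr2 -chiD subrr chi0.
under eq_bigr do rewrite mulrACA -chiD -mulrBr.
by rewrite -mulr_sumr sum_chi_mul subr_eq0 eq_sym (negPf kj) mulr0.
Qed.

Lemma gauss_sqr : gauss ^+ 2 = (eta (- 1))%:~R * p%:R.
Proof.
have e1 : (eta (- 1))%:~R ^+ 2 = 1 :> C.
  by rewrite -rmorphXn eta_sqr // oppr_eq0 oner_neq0.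
transitivity ((eta (- 1))%:~R ^+ 2 * gauss ^+ 2); first by rewrite e1 mul1r.
by rewrite -gauss_norm conj_gauss; ring.
Qed.

Lemma gauss_neq0 : gauss != 0.
Proof.
apply: contra_eq_neq gauss_norm => ->.
by rewrite mul0r eq_sym pnatr_eq0 -lt0n prime_gt0.
Qed.

(** * Exponential sums and the Galois action *)

Lemma sum_chi_levels (X : finType) (S : pred X) (u : X -> F) :
  \sum_(x | S x) chi (u x) = \sum_j (#|[pred x | S x & u x == j]|%:Z)%:~R * chi j.
Proof.
rewrite (partition_big u xpredT) //=; apply: eq_bigr => j _.
rewrite (eq_bigr (fun=> chi j)) => [|x /andP[_ /eqP->]] //.
by rewrite sumr_const mulr_natl.
Qed.

Lemma cycint_sum_chi (X : finType) (S : pred X) (u : X -> F) :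
  cycint (\sum_(x | S x) chi (u x)).
Proof. by rewrite sum_chi_levels; exists (fun j => #|[pred x | S x & u x == j]|%:Z). Qed.

Lemma sum_chi_galois (X : finType) (S : pred X) (u : X -> F) (a : F -> int) t :
  t != 0 -> \sum_(x | S x) chi (u x) = \sum_j (a j)%:~R * chi j ->
  \sum_(x | S x) chi (t * u x) = \sum_j (a j)%:~R * chi (t * j).
Proof.
move=> t0; rewrite sum_chi_levels => /eqP; rewrite -subr_eq0 -sumrB.
under eq_bigr do rewrite -mulrBl -rmorphB.
move/eqP/(chi_galois t0); under eq_bigr do rewrite rmorphB mulrBl.
rewrite sumrB => /eqP; rewrite subr_eq0 => /eqP <-.
rewrite (partition_big u xpredT) //=; apply: eq_bigr => j _.
rewrite (eq_bigr (fun=> chi (t * j))) => [|x /andP[_ /eqP->]] //.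
by rewrite sumr_const mulr_natl.
Qed.

Lemma gauss_chi (k : int) b :
  k%:~R * (gauss * chi b) = \sum_j (k * eta (j - b))%:~R * chi j.
Proof.
rewrite mulr_suml mulr_sumr [RHS](reindex_inj (addIr b)) /=.
by apply: eq_bigr => j _; rewrite addrK chiD intrM !mulrA.
Qed.

(** The automorphism sending z to z ^ t multiplies the Gauss sum by [eta t]. *)
Lemma sum_chi_galois_gauss (X : finType) (S : pred X) (u : X -> F) (k : int) b t :
  t != 0 -> \sum_(x | S x) chi (u x) = k%:~R * (gauss * chi b) ->
  \sum_(x | S x) chi (t * u x) = (eta t)%:~R * (k%:~R * (gauss * chi (t * b))).
Proof.
move=> t0; rewrite gauss_chi => /(sum_chi_galois t0) ->.
rewrite (reindex_inj (addIr b)) /= mulrCA (mulrA (eta t)%:~R) -gauss_mul.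
rewrite mulr_suml mulr_sumr; apply: eq_bigr => j _.
by rewrite addrK mulrDr chiD intrM !mulrA.
Qed.

(* The argument of Kumar, Scholtz and Welch: since [p] is totally ramified in
   Z[z], the sum divided by [p ^ m * gauss] is an algebraic integer of norm 1. *)
Lemma sum_chi_norm (X : finType) (u : X -> F) m :
  (\sum_x chi (u x)) * (\sum_x chi (u x))^* = p%:R ^+ (m + m).+1 ->
  exists (s : bool) b, \sum_x chi (u x) = ((-1) ^+ s * p%:Z ^+ m)%:~R * (gauss * chi b).
Proof.
move=> e; set W := \sum_x _ in e *.
have cW : cycint W := cycint_sum_chi _ _.
have cg : cycint gauss by exists eta.
have p0 : p%:R != 0 :> C by rewrite pnatr_eq0 -lt0n prime_gt0.
(* The factor [gauss^*] raises the norm from p ^ (2m + 1) to the even power p ^ (2m + 2) that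
   [cycint_dvd_norm] asks for. *)
have [|y cy yE] := @cycint_dvd_norm m.+1 (W * gauss^*) (cycintM cW (cycint_conj cg)).
  rewrite rmorphM /= conjCK mulrACA e [_^* * _]mulrC gauss_norm -exprSr.
  by rewrite addSn addnS.
have [|s [b yb]] := cycint_norm1 cy.
  have pm0 : p%:R ^+ m.+1 * p%:R ^+ m.+1 != 0 :> C by rewrite mulf_neq0 ?expf_neq0.
  apply: (mulfI pm0); rewrite mulr1 mulrACA.
  transitivity ((W * gauss^*) * (W * gauss^*)^*).
    by rewrite yE rmorphM rmorphXn /= conjC_nat.
  rewrite rmorphM /= conjCK mulrACA e [_^* * _]mulrC gauss_norm -exprSr -exprD.
  by rewrite addSn addnS.
exists s, b; apply: (mulIf p0); rewrite -[X in _ * X = _]gauss_norm.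
rewrite [gauss * _]mulrC mulrA yE yb rmorphM rmorph_sign rmorphXn /= exprSr.
ring.
Qed.

(** * Bent functions and their duals *)

Section BentFunctions.

Variable n : nat.
Local Notation X := 'rV[F]_n.

Lemma Fp_expf_coprime (x : F) k : x != 0 -> coprime k p.-1 -> x ^+ k = 1 -> x = 1.
Proof.
move=> x0 cok; have [g g_prim] := Fp_prim_root.
have [i ->] := prim_rootP g_prim (Fp_expf_pred x0).
rewrite -exprM => /eqP; rewrite -(prim_order_dvd g_prim) Gauss_dvdl.
  by rewrite (prim_order_dvd g_prim) => /eqP.
by rewrite coprime_sym.
Qed.

Lemma dotpC (a x : X) : dotp a x = dotp x a.
Proof. by apply: eq_bigr => i _; rewrite mulrC. Qed.

Lemma dotpDr (a x y : X) : dotp a (x + y) = dotp a x + dotp a y.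
Proof. by rewrite -big_split; apply: eq_bigr => i _; rewrite mxE mulrDr. Qed.

Lemma dotpZr t (a x : X) : dotp a (t *: x) = t * dotp a x.
Proof. by rewrite mulr_sumr; apply: eq_bigr => i _; rewrite mxE mulrCA. Qed.

Lemma dotpDl (a b x : X) : dotp (a + b) x = dotp a x + dotp b x.
Proof. by rewrite -!(dotpC x) dotpDr. Qed.

Lemma dotpZl t (a x : X) : dotp (t *: a) x = t * dotp a x.
Proof. by rewrite -!(dotpC x) dotpZr. Qed.

Lemma dotpNr (a x : X) : dotp a (- x) = - dotp a x.
Proof. by rewrite -scaleN1r dotpZr mulN1r. Qed.

Lemma dotpNl (a x : X) : dotp (- a) x = - dotp a x.
Proof. by rewrite -!(dotpC x) dotpNr. Qed.

Lemma dotp0l (x : X) : dotp 0 x = 0.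
Proof. by rewrite -(scale0r x) dotpZl mul0r. Qed.

Lemma card_rV_Fp : #|{: X}| = (p ^ n)%N.
Proof. by rewrite card_mx card_Fp // mul1n. Qed.

Lemma sum_chi_dotp (a : X) :
  \sum_x chi (dotp a x) = if a == 0 then p%:R ^+ n else 0.
Proof.
case: eqP => [->|/eqP/rV0Pn[i ai0]].
  under eq_bigr do rewrite dotp0l chi0.
  by rewrite sumr_const cardT -cardE card_rV_Fp natrX.
have [y ay] : exists y, dotp a y = 1.
  exists ((a 0 i)^-1 *: delta_mx 0 i); rewrite dotpZr /dotp (bigD1 i) //=.
  rewrite mxE !eqxx big1 ?addr0 ?mulr1 ?mulVf // => j /negPf ji.
  by rewrite mxE eqxx ji mulr0.
apply/eqP; have: (chi 1 - 1) * (\sum_x chi (dotp a x)) = 0.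
  rewrite mulrBl mul1r mulr_sumr [X in _ - X](reindex_inj (addrI y)) /=.
  by rewrite -sumrB big1 // => x _; rewrite dotpDr ay chiD subrr.
by move/eqP; rewrite mulf_eq0 subr_eq0 chi_eq1 oner_eq0.
Qed.

Lemma sum_chi_dotpB (u v : X) :
  \sum_a chi (dotp a u - dotp a v) = if u == v then p%:R ^+ n else 0.
Proof.
rewrite -subr_eq0 -sum_chi_dotp; apply: eq_bigr => a _.
by rewrite (dotpC (u - v)) dotpDr dotpNr.
Qed.

Lemma fourier_inv (w : X -> C) (y : X) :
  \sum_a (\sum_x w x * chi (- dotp a x)) * chi (dotp a y) = p%:R ^+ n * w y.
Proof.
under eq_bigr do rewrite mulr_suml.
rewrite exchange_big /= (bigD1 y) //= [X in _ + X]big1 => [|x xy].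
  under eq_bigr do rewrite -mulrA -chiD addrC.
  by rewrite -mulr_sumr sum_chi_dotpB eqxx addr0 mulrC.
under eq_bigr do rewrite -mulrA -chiD addrC.
by rewrite -mulr_sumr sum_chi_dotpB eq_sym (negPf xy) mulr0.
Qed.

Lemma fourier_parseval (w : X -> C) :
  \sum_a (\sum_x w x * chi (- dotp a x)) * (\sum_x w x * chi (- dotp a x))^* =
  p%:R ^+ n * \sum_x w x * (w x)^*.
Proof.
under eq_bigr do rewrite rmorph_sum mulr_sumr /=.
rewrite exchange_big mulr_sumr /=; apply: eq_bigr => y _.
rewrite mulrA -fourier_inv mulr_suml; apply: eq_bigr => a _.
by rewrite rmorphM /= conj_chi opprK mulrCA [LHS]mulrC -mulrA.
Qed.

Definition chi_walsh (f : X -> F) (a : X) : C := \sum_x chi (f x - dotp a x).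

Lemma chi_walsh_inv (f : X -> F) (x : X) :
  \sum_a chi_walsh f a * chi (dotp a x) = p%:R ^+ n * chi (f x).
Proof.
rewrite -(fourier_inv (fun x => chi (f x))); apply: eq_bigr => a _.
by congr (_ * _); apply: eq_bigr => y _; rewrite chiD.
Qed.

Variable m : nat.
Hypothesis nE : n = (m + m).+1.

(* [g] is the dual of [f], and [s] records the sign of its Walsh transform,
   normalised by the Gauss sum rather than by [mu * p ^ (n / 2)]. *)
Definition signed_dual (f : X -> F) (s : X -> bool) (g : X -> F) := forall a,
  chi_walsh f a = ((-1) ^+ s a * p%:Z ^+ m)%:~R * (gauss * chi (g a)).

Lemma bent_signed_dual f : (forall a, chi_walsh f a * (chi_walsh f a)^* = p%:R ^+ n) ->
  exists s g, signed_dual f s g.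
Proof.
move=> fB; have sg a : {sb : bool * F |
    chi_walsh f a == ((-1) ^+ sb.1 * p%:Z ^+ m)%:~R * (gauss * chi sb.2)}.
  apply/sigW; have := fB a; rewrite [in _ ^+ n]nE => /sum_chi_norm[s [b e]].
  by exists (s, b); apply/eqP.
exists (fun a => (sval (sg a)).1), (fun a => (sval (sg a)).2) => a.
by case: (sg a) => /= sb /eqP.
Qed.

Let eta_N1_sqr : eta (- 1) ^+ 2 = 1.
Proof. by rewrite eta_sqr // oppr_eq0 oner_neq0. Qed.

Let pm_gauss_neq0 : (p%:Z ^+ m)%:~R * gauss != 0.
Proof.
rewrite mulf_neq0 ?gauss_neq0 // rmorphXn expf_neq0 // pnatr_eq0 -lt0n.
exact: prime_gt0.
Qed.

Let pm_gauss_sqr : ((p%:Z ^+ m)%:~R * gauss) ^+ 2 = (eta (- 1))%:~R * p%:R ^+ n.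
Proof.
rewrite exprMn gauss_sqr rmorphXn /= -pmulrn [in p%:R ^+ n]nE.
by rewrite [in RHS]exprSr exprD -expr2 mulrCA.
Qed.

Let pm_odd : exists k, p%:Z ^+ m = k * 2 + 1.
Proof.
have p_odd_m : odd (p ^ m) by rewrite oddX p_odd orbT.
exists (p ^ m)./2%:Z; rewrite -(natz p) -natrX natz -PoszM -PoszD muln2 addn1.
by have := odd_double_half (p ^ m); rewrite p_odd_m add1n => ->.
Qed.

(** Fourier inversion, divided by p ^ m times the Gauss sum; the square of that number is
    [eta (- 1)] times p ^ n, whence the factor [eta (- 1)]. *)
Lemma signed_dual_inv f s g : signed_dual f s g -> forall x,
  \sum_a (-1) ^+ s a * chi (g a - dotp x a) =
  (eta (- 1) * p%:Z ^+ m)%:~R * (gauss * chi (f (- x))).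
Proof.
move=> fg x; apply: (mulfI pm_gauss_neq0).
transitivity (\sum_a chi_walsh f a * chi (dotp a (- x))).
  rewrite mulr_sumr; apply: eq_bigr => a _.
  by rewrite fg dotpNr (dotpC a) chiD rmorphM rmorph_sign; ring.
rewrite chi_walsh_inv [RHS](_ : _ =
    (eta (- 1))%:~R * ((p%:Z ^+ m)%:~R * gauss) ^+ 2 * chi (f (- x))).
  by rewrite pm_gauss_sqr mulrA -intrM -expr2 eta_N1_sqr mul1r.
by rewrite rmorphM /=; ring.
Qed.

(* The sums over the two sign classes have integral coefficients, so their sum
   and difference, [chi_walsh g x] and [signed_dual_inv], are congruent
   modulo 2. *)
Lemma dual_dual f s g t h : signed_dual f s g -> signed_dual g t h ->
  forall x, h x = f (- x).
Proof.
move=> fg gh x; apply/eqP; rewrite -[_ == _]negbK; apply/negP => hf.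
pose N j := #|[pred a | ~~ s a & g a - dotp x a == j]|.
have: \sum_j ((N j).*2%:Z - ((-1) ^+ t x * p%:Z ^+ m * eta (j - h x)
   + eta (- 1) * p%:Z ^+ m * eta (j - f (- x))))%:~R * chi j = 0.
  under eq_bigr do rewrite rmorphB rmorphD !mulrBl mulrDl.
  rewrite sumrB big_split /= -!gauss_chi -(signed_dual_inv fg).
  rewrite -gh (_ : \sum_j _ = 2 * \sum_(a | ~~ s a) chi (g a - dotp x a)).
    rewrite mulr_natl big_mkcond /= -sumrMnl -big_split -sumrB big1 //= => a _.
    by case: (s a); rewrite ?expr1 ?expr0 /=; ring.
  rewrite sum_chi_levels mulr_sumr; apply: eq_bigr => j _.
  by rewrite /N -muln2 PoszM rmorphM /=; ring.
move/chi_lin_indep => cst.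
set b := f (- x) in hf cst *; set c := h x in hf cst *.
have d0 : b - c != 0 by rewrite subr_eq0 eq_sym.
have [k Kk] := pm_odd.
(* At [b] one [eta] term vanishes and the other is odd; at [b + (b - c)] both are odd. The two
   coefficients, which should be equal, thus differ in parity. *)
have := cst b; rewrite -(cst (b + (b - c))).
have -> : b + (b - c) - b = b - c by ring.
have -> : b + (b - c) - c = 2 * (b - c) by ring.
rewrite subrr eta0 mulr0 addr0 etaM Kk.
have [s1 [-> _]] := eta_sign d0; have [s2 [-> _]] := eta_sign Fp_two_neq0.
have N10 : (-1 : F) != 0 by rewrite oppr_eq0 oner_neq0.
have [s3 [-> _]] := eta_sign N10.
move: (N b) (N _) (t x) (k); clear - s1 s2 s3 => N1 N2 s4 l.
by case: s1; case: s2; case: s3; case: s4; rewrite ?expr1 ?expr0; lia.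
Qed.

Lemma rV_opp_neq (x : X) : x != 0 -> - x != x.
Proof.
apply: contraNneq => eq_x; have /eqP : 2 *: x = 0.
  by rewrite scaler_nat mulr2n -{1}eq_x addNr.
by rewrite scaler_eq0 (negPf Fp_two_neq0).
Qed.

Lemma even_card_sym (S : {set X}) :
  (forall x, x \in S -> - x \in S) -> 0 \notin S -> ~~ odd #|S|.
Proof.
move=> symS S0; pose f (x : X) := [set x; - x].
rewrite (card_uniform_partition (n := 2) _ (preim_partitionP f S)).
  by rewrite oddM andbF.
move=> _ /imsetP[x xS ->]; have x0 : x != 0 by apply: contraNneq S0 => <-.
rewrite (_ : [set y in S | f x == f y] = f x) ?cards2 1?eq_sym ?rV_opp_neq //.
apply/setP => y; rewrite !inE; apply/andP/orP => [[yS /eqP fxy]|].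
  have : y \in f x by rewrite fxy !inE eqxx.
  by rewrite !inE => /orP.
case=> /eqP ->; first by rewrite eqxx.
by rewrite symS // /f opprK setUC eqxx.
Qed.

(** Replacing x by c x in the transform at [(e / c) *: a] gives the Galois conjugate by [e] of the
    transform at [a]; the Gauss sum is fixed because [eta e = 1]. *)
Lemma signed_dual_scale f s g c e : signed_dual f s g ->
  c != 0 -> e != 0 -> eta e = 1 -> (forall x, f (c *: x) = e * f x) ->
  forall a, s ((e / c) *: a) = s a /\ g ((e / c) *: a) = e * g a.
Proof.
move=> fg c0 e0 eta_e fc a.
have : chi_walsh f ((e / c) *: a) = \sum_x chi (e * (f x - dotp a x)).
  rewrite [LHS](reindex_inj (scalerI c0)); apply: eq_bigr => x _.
  by rewrite fc dotpZl dotpZr mulrA divfK // mulrBr.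
rewrite (sum_chi_galois_gauss e0 (fg a)) fg eta_e mul1r.
rewrite !rmorphM !rmorph_sign -!mulrA !(mulrCA ((-1) ^+ _)).
rewrite !(mulrA _ gauss) => eq_gh.
apply: sign_chi_inj; apply: (mulfI pm_gauss_neq0).
by rewrite !(mulrCA _ ((-1) ^+ _)); move: eq_gh; rewrite !(mulrCA _ ((-1) ^+ _)).
Qed.

Lemma signed_dual_even f s g : signed_dual f s g -> (forall x, f (- x) = f x) ->
  forall a, s (- a) = s a /\ g (- a) = g a.
Proof.
move=> fg f_even a; have N10 : (-1 : F) != 0 by rewrite oppr_eq0 oner_neq0.
have [x|] := signed_dual_scale fg N10 (oner_neq0 _) eta1 _ a.
  by rewrite scaleN1r mul1r.
by rewrite mul1r invrN1 scaleN1r mul1r.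
Qed.

(* If [g 0 <> 0], the numbers of solutions of [f x = g 0] and of [f x = - g 0]
   are both even, whereas they differ by an odd number. *)
Lemma signed_dual_0 f s g : signed_dual f s g -> (forall x, f (- x) = f x) ->
  f 0 = 0 -> g 0 = 0.
Proof.
move=> fg f_even f0; apply/eqP; rewrite -[_ == _]negbK; apply/negP => g0.
pose S j := [set x | f x == j].
have evS j : j != 0 -> ~~ odd #|S j|.
  move=> j0; apply: even_card_sym => [x|]; rewrite !inE ?f_even //.
  by rewrite f0 eq_sym.
have: \sum_j (#|S j|%:Z - (-1) ^+ s 0 * p%:Z ^+ m * eta (j - g 0))%:~R * chi j = 0.
  under eq_bigr do rewrite rmorphB mulrBl.
  rewrite sumrB -gauss_chi -fg /chi_walsh; apply/eqP; rewrite subr_eq0; apply/eqP.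
  under [RHS]eq_bigr do rewrite dotp0l subr0.
  rewrite sum_chi_levels; apply: eq_bigr => j _; congr (_%:~R * _).
  by congr Posz; apply: eq_card => x; rewrite !inE.
move/chi_lin_indep => cst.
have := cst (g 0); rewrite -(cst (- g 0)).
rewrite subrr eta0 mulr0 subr0; have [k ->] := pm_odd.
have N20 : - g 0 - g 0 != 0.
  have -> : - g 0 - g 0 = 2 * - g 0 by ring.
  by rewrite mulf_neq0 ?oppr_eq0 ?Fp_two_neq0.
have [s1 [-> _]] := eta_sign N20.
have Ng0 : - g 0 != 0 by rewrite oppr_eq0.
have := evS _ g0; have := evS _ Ng0; move: #|_| #|_| => N1 N2 ev1 ev2.
rewrite -(even_halfK ev1) -(even_halfK ev2) -!muln2 !PoszM.
move: (s 0) (k) _./2 _./2; clear - s1 => s2 l M1 M2.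
by case: s1; case: s2; rewrite ?expr1 ?expr0; lia.
Qed.

(** The full sum and the [t]-weighted sum agree up to sign. Half their sum and half their difference
    isolate the classes of [t], and [s a] decides which of them vanishes. *)
Lemma half_sums f g s (t : X -> bool) (e c : bool) a : signed_dual f s g ->
  (forall a, \sum_x (-1) ^+ t x * chi (f x - dotp a x) =
     ((-1) ^+ e * p%:Z ^+ m)%:~R * (gauss * chi (g a))) ->
  \sum_(x | t x == c) chi (f x - dotp a x) =
    ((s a == c (+) e)%:R * ((-1) ^+ (c (+) e) * p%:Z ^+ m))%:~R * (gauss * chi (g a)) /\
  \sum_(x | t x != c) chi (f x - dotp a x) =
    (- ((s a != c (+) e)%:R * ((-1) ^+ (c (+) e) * p%:Z ^+ m)))%:~R * (gauss * chi (g a)).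
Proof.
move=> fg fgt; have := fgt a; have := fg a; rewrite /chi_walsh.
rewrite (bigID (fun x => t x == c)) /= => eD.
rewrite (bigID (fun x => t x == c)) /= => eB.
set S1 := \sum_(x | t x == c) _ in eD *; set S2 := \sum_(x | t x != c) _ in eD *.
have {eB} : (-1) ^+ c * (S1 - S2) = ((-1) ^+ e * p%:Z ^+ m)%:~R * (gauss * chi (g a)).
  rewrite -eB mulrBr !mulr_sumr -sumrN; congr (_ + _); apply: eq_bigr => x.
    by move/eqP ->.
  move=> tc; have -> : t x = ~~ c by move: tc; case: (t x); case: (c).
  by rewrite signrN mulNr.
move: (gauss * _) eD => Y; rewrite !rmorphN !rmorphM /= !rmorph_sign => eD eB.
have {eB} : S1 - S2 = (-1) ^+ c * ((-1) ^+ e * (p%:Z ^+ m)%:~R * Y).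
  by rewrite -eB mulrA -signr_addb addbb expr0 mul1r.
move: (p%:Z ^+ m)%:~R eD => K eD eB.
have eS1 : S1 = (S1 + S2 + (S1 - S2)) / 2 by field.
have eS2 : S2 = (S1 + S2 - (S1 - S2)) / 2 by field.
split; [rewrite eS1 | rewrite eS2]; rewrite eD eB.
  by case: (s a); case: (c); case: (e); rewrite /= ?expr1 ?expr0; field.
by case: (s a); case: (c); case: (e); rewrite /= ?expr1 ?expr0; field.
Qed.

(* The exponential sums of the multiples of [f] over [A] and over its complement
   are supported on [B] and on its complement respectively; [rho] is the
   substitution through which the multiplier acts on the values of the dual. *)
Definition dual_side (A B : {set X}) (f g : X -> F) (c : int) (rho : F -> F) :=
  forall t a, t != 0 ->
  \sum_(x in A) chi (t * f x - dotp a x) =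
    ((a \in B)%:R * (eta t * c))%:~R * (gauss * chi (rho t * g a)) /\
  \sum_(x in ~: A) chi (t * f x - dotp a x) =
    (- ((a \notin B)%:R * (eta t * c)))%:~R * (gauss * chi (rho t * g a)).

(** Factoring out the multiplier [u] leaves a Galois conjugate of the sum at [u^-1 *: a]; the
    scaling hypothesis leads back to [a]. *)
Lemma dual_side_of_signed f g s (t : X -> bool) (e c : bool) rho : signed_dual f s g ->
  (forall a, \sum_x (-1) ^+ t x * chi (f x - dotp a x) =
     ((-1) ^+ e * p%:Z ^+ m)%:~R * (gauss * chi (g a))) ->
  (forall u a, u != 0 -> s (u^-1 *: a) = s a /\ u * g (u^-1 *: a) = rho u * g a) ->
  dual_side [set x | t x == c] [set a | s a == c (+) e] f g
    ((-1) ^+ (c (+) e) * p%:Z ^+ m) rho.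
Proof.
move=> fg fgt scal u a u0; have [sE <-] := scal u a u0.
have [e1 e2] := half_sums c (u^-1 *: a) fg fgt.
have argE x : u * f x - dotp a x = u * (f x - dotp (u^-1 *: a) x).
  by rewrite dotpZl mulrBr mulrA divff // mul1r.
split.
  under eq_bigl do rewrite inE; under eq_bigr do rewrite argE.
  rewrite (sum_chi_galois_gauss u0 e1) inE -sE.
  by rewrite mulrA -intrM; congr (_%:~R * _); ring.
under eq_bigl do rewrite !inE; under eq_bigr do rewrite argE.
rewrite (sum_chi_galois_gauss u0 e2) inE -sE.
by rewrite mulrA -intrM; congr (_%:~R * _); ring.
Qed.

(** Common features of b -> b / b ^ h and of its inverse; since [h] is even, both preserve quadratic
    classes. *)
Definition square_twist (rho : F -> F) := [/\ injective rho, rho 0 = 0 &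
  forall u, u != 0 -> exists2 v, v != 0 & rho u = u * v ^+ 2].

Lemma square_twist_inv rho rho' : square_twist rho -> cancel rho' rho ->
  square_twist rho'.
Proof.
move=> [rho_inj rho0 rho_sq] rhoK; have r0 : rho' 0 = 0 by apply: rho_inj; rewrite rhoK.
split=> [||u u0]; [exact: can_inj rhoK | by [] |].
have r'u0 : rho' u != 0 by apply: contra_neq u0 => e; rewrite -(rhoK u) e.
have [v v0 e] := rho_sq _ r'u0; exists v^-1; first by rewrite invr_eq0.
by rewrite -[in RHS](rhoK u) e -mulrA -exprMn divff // expr1n mulr1.
Qed.

Let odd_predn_coprime k : coprime k p.-1 -> odd k.
Proof. by rewrite -coprimen2; apply: coprime_dvdr; rewrite p_half dvdn_mull. Qed.

Lemma homogeneous_even (f : X -> F) h : (0 < h)%N -> coprime h.-1 p.-1 ->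
  (forall (b : F) x, b != 0 -> f (b *: x) = b ^+ h * f x) ->
  forall x, f (- x) = f x.
Proof.
move=> h0 /odd_predn_coprime odd_h1 fh x.
rewrite -scaleN1r fh ?oppr_eq0 ?oner_neq0 // -(prednK h0) -signr_odd /= odd_h1.
by rewrite expr0 mul1r.
Qed.

Lemma dual_sides f g s t h (e : bool) : signed_dual f s g -> signed_dual g t f ->
  f 0 = 0 -> (0 < h)%N -> coprime h.-1 p.-1 ->
  (forall (b : F) x, b != 0 -> f (b *: x) = b ^+ h * f x) ->
  eta (- 1) = (-1) ^+ e ->
  [/\ g 0 = 0, (forall x, g (- x) = g x) /\ (forall x, f (- x) = f x) &
    exists rho rho', [/\ square_twist rho, square_twist rho' &
    forall c (A := [set x | t x == c]) (B := [set a | s a == c (+) e]),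
    dual_side A B f g ((-1) ^+ (c (+) e) * p%:Z ^+ m) rho /\
    dual_side B A g f ((-1) ^+ c * p%:Z ^+ m) rho']].
Proof.
move=> fg gf f0 h0 coh fh eE.
have odd_h1 := odd_predn_coprime coh.
have h_half : h = (h./2 * 2)%N.
  have := odd_double_half h; rewrite -(prednK h0) oddS odd_h1 /= -muln2 => {1}<-.
  by rewrite add0n.
have f_even := homogeneous_even h0 coh fh.
have gE := signed_dual_even fg f_even.
have g_even x : g (- x) = g x by have [] := gE x.
have g0 := signed_dual_0 fg f_even f0.
split=> //.
have eta_h b : b != 0 -> eta (b ^+ h) = 1.
  move=> b0; rewrite h_half exprM expr2 etaM -expr2 eta_sqr // expf_neq0 //.
(* By homogeneity [b * f (b^-1 *: x) = rho' b * f x]. Injectivity holds because [h - 1] is prime to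
   [p - 1]; the dual [g] transforms by the inverse [rho]. *)
pose rho' (b : F) := b / b ^+ h.
have rho'_eq0 b : (rho' b == 0) = (b == 0).
  by rewrite mulf_eq0 invr_eq0 expf_eq0 h0 /= orbb.
have rho'_twist : square_twist rho'.
  split=> [b b' e_bb'||b b0]; last 1 first.
  - exists (b ^+ h./2)^-1; first by rewrite invr_eq0 expf_neq0.
    by rewrite exprVn -exprM -h_half.
  - have [b0|b0] := eqVneq b 0.
      by apply/esym/eqP; rewrite b0 -rho'_eq0 -e_bb' rho'_eq0 b0.
    have b'0 : b' != 0 by rewrite -rho'_eq0 -e_bb' rho'_eq0.
    suff : b / b' = 1 by move/(canRL (divfK b'0)); rewrite mul1r.
    apply: Fp_expf_coprime coh _; first by rewrite mulf_neq0 ?invr_eq0.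
    move: e_bb'; rewrite /rho' -(prednK h0) !exprS !invfM !mulVKf //.
    by move/invr_inj => e_bb'; rewrite exprMn e_bb' -exprMn divff ?expr1n.
  - by rewrite /rho' mul0r.
have [rho'_inj _ _] := rho'_twist.
pose rho := invF rho'_inj.
have rhoK : cancel rho rho' := f_invF rho'_inj.
have scal_s b a : b != 0 ->
    s ((b ^+ h / b) *: a) = s a /\ g ((b ^+ h / b) *: a) = b ^+ h * g a.
  move=> b0; apply: (signed_dual_scale fg b0 (expf_neq0 _ b0) (eta_h _ b0)) => x.
  exact: fh.
have scal_t b x : b != 0 -> t (b *: x) = t x.
  move=> b0; have bh0 : b ^+ h != 0 by rewrite expf_neq0.
  have bhb0 : b ^+ h / b != 0 by rewrite mulf_neq0 ?invr_eq0.
  (* Going from [f] to [g] and back, the scalars combine to b ^ h / (b ^ h / b) = b. *)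
  have [|] := signed_dual_scale gf bhb0 bh0 (eta_h _ b0) _ x.
    by move=> a; have [] := scal_s b a b0.
  by rewrite invfM invrK mulrA divff // mul1r.
exists rho, rho'; split=> //; first exact: square_twist_inv rhoK.
move=> c A B; split.
  apply: dual_side_of_signed fg _ _ => [a|u a u0].
    by rewrite (signed_dual_inv gf) eE (proj2 (gE a)).
  have r0 : rho u != 0 by rewrite -rho'_eq0 rhoK.
  have uE : u^-1 = rho u ^+ h / rho u by rewrite -{1}(rhoK u) /rho' invfM invrK mulrC.
  rewrite uE; have [-> ->] := scal_s _ a r0; split=> //.
  by rewrite mulrA; congr (_ * _); rewrite -{1}(rhoK u) /rho' divfK ?expf_neq0.
have -> : A = [set x | t x == (c (+) e) (+) e] by rewrite -addbA addbb addbF.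
have -> : (-1) ^+ c = (-1) ^+ ((c (+) e) (+) e) :> int by rewrite -addbA addbb addbF.
apply: dual_side_of_signed gf _ _ => [x|u x u0].
  by rewrite (signed_dual_inv fg) eE f_even.
have u'0 : u^-1 != 0 by rewrite invr_eq0.
by rewrite scal_t // fh // exprVn mulrA.
Qed.

End BentFunctions.

(** * Fourier transforms of level sets *)

Section LevelSchemes.

Variable n : nat.
Local Notation X := 'rV[F]_n.

Definition hat (A : {set X}) (a : X) : C := \sum_(x in A) chi (- dotp a x).

Lemma hat_inv (A : {set X}) x :
  \sum_a hat A a * chi (dotp a x) = p%:R ^+ n * (x \in A)%:R.
Proof.
rewrite -(fourier_inv (fun x => (x \in A)%:R)); apply: eq_bigr => a _.
congr (_ * _); rewrite /hat big_mkcond /=; apply: eq_bigr => y _.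
by case: (y \in A); rewrite ?mul1r ?mul0r.
Qed.

Lemma hat_parseval (A : {set X}) :
  \sum_a hat A a * (hat A a)^* = p%:R ^+ n * #|A|%:R.
Proof.
transitivity (p%:R ^+ n * \sum_x (x \in A)%:R * ((x \in A)%:R)^* : C).
  rewrite -fourier_parseval; apply: eq_bigr => a _.
  have -> : hat A a = \sum_x (x \in A)%:R * chi (- dotp a x) => //.
  rewrite /hat big_mkcond /=; apply: eq_bigr => y _.
  by case: (y \in A); rewrite ?mul1r ?mul0r.
congr (_ * _); rewrite -sum1_card natr_sum [RHS]big_mkcond /=; apply: eq_bigr => x _.
by rewrite conjC_nat -natrM mulnb andbb; case: (x \in A).
Qed.

Lemma hat0 (A : {set X}) : hat A 0 = #|A|%:R.
Proof.
rewrite /hat -sum1_card natr_sum; apply: eq_bigr => x _.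
by rewrite dotp0l oppr0 chi0.
Qed.

Lemma sum_hatC (A B : {set X}) : \sum_(a in B) hat A a = \sum_(x in A) hat B x.
Proof.
rewrite exchange_big /=; apply: eq_bigr => x _; apply: eq_bigr => a _.
by rewrite dotpC.
Qed.

Lemma hatC (A : {set X}) a :
  hat (~: A) a = (if a == 0 then p%:R ^+ n else 0) - hat A a.
Proof.
apply/eqP; rewrite eq_sym subr_eq -oppr_eq0 -(sum_chi_dotp (- a)).
rewrite (bigID (mem A)) /= addrC; apply/eqP; congr (_ + _); last first.
  by apply: eq_bigr => x _; rewrite dotpNl.
by apply: eq_big => x; rewrite ?inE // dotpNl.
Qed.

Section DualSide.

Variables (A B : {set X}) (f g : X -> F) (c : int) (rho : F -> F).
Hypotheses (H : dual_side A B f g c rho) (rho_sq : square_twist rho).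

Let rho_inj : injective rho. Proof. by case: rho_sq. Qed.
Let rho0 : rho 0 = 0. Proof. by case: rho_sq. Qed.

Lemma square_twist_eq0 t : (rho t == 0) = (t == 0).
Proof. by rewrite -{1}rho0 (inj_eq rho_inj). Qed.

Lemma square_twist_eta t : eta (rho t) = eta t.
Proof.
have [->|t0] := eqVneq t 0; first by rewrite rho0.
by have [_ _ /(_ t t0)[v v0 ->]] := rho_sq; rewrite eta_mul_sqr.
Qed.

(* The Gauss-type sum through which the indicator of [P \o f] sees [g]. *)
Definition level_kernel (P : pred F) (b : F) : C :=
  \sum_(t | t != 0) (eta t)%:~R * chi (rho t * b) * \sum_(j | P j) chi (- (t * j)).

Let level_indicator (P : pred F) (y : F) :
  \sum_t \sum_(j | P j) chi (t * y - t * j) = p%:R * (P y)%:R.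
Proof.
rewrite exchange_big /=; under eq_bigr do under eq_bigr do rewrite -mulrBr.
under eq_bigr do rewrite sum_chi_mul subr_eq0 eq_sym.
rewrite -big_mkcondr /= (eq_bigl (fun j => P y && (j == y))); last first.
  by move=> j; case: eqP => [->|]; rewrite ?andbT ?andbF.
by case: (P y); [rewrite (big_pred1 y) ?mulr1 | rewrite big_pred0 ?mulr0].
Qed.

(** The condition [P (f x)] is expanded in the characters [chi (t * f x)]; the first term is the
    contribution of t = 0. *)
Let hat_level_gen (S : {set X}) (k : F -> C) (P : pred F) a :
  (forall t, t != 0 -> \sum_(x in S) chi (t * f x - dotp a x) = k t) ->
  p%:R * hat [set x in S | P (f x)] a =
  #|P|%:R * hat S a + \sum_(t | t != 0) k t * \sum_(j | P j) chi (- (t * j)).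
Proof.
move=> kE.
transitivity (\sum_t (\sum_(x in S) chi (t * f x - dotp a x)) *
                     \sum_(j | P j) chi (- (t * j))).
  rewrite /hat big_mkcond mulr_sumr.
  under [RHS]eq_bigr do rewrite mulr_suml.
  rewrite exchange_big /= [RHS]big_mkcond; apply: eq_bigr => x _.
  rewrite inE; case: (x \in S); rewrite ?mulr0 //=.
  transitivity (p%:R * (P (f x))%:R * chi (- dotp a x)).
    by case: (P _); rewrite ?mulr1 ?mulr0 ?mul0r.
  rewrite -level_indicator mulr_suml; apply: eq_bigr => t _.
  rewrite mulr_suml mulr_sumr; apply: eq_bigr => j _.
  by rewrite -!chiD; congr (chi _); ring.
rewrite (bigD1 0) //=; congr (_ + _); last by apply: eq_bigr => t t0; rewrite kE.
rewrite mulrC; congr (_ * _).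
  under eq_bigr do rewrite mul0r oppr0 chi0.
  by rewrite sumr_const.
by apply: eq_bigr => x _; rewrite mul0r add0r.
Qed.

Lemma hat_level (P : pred F) a :
  p%:R * hat [set x in A | P (f x)] a =
  #|P|%:R * hat A a + (a \in B)%:R * (c%:~R * gauss) * level_kernel P (g a).
Proof.
rewrite (hat_level_gen (k := fun t => (a \in B)%:R * (c%:~R * gauss) *
  ((eta t)%:~R * chi (rho t * g a)))) => [|t t0]; last first.
  by have [-> _] := H a t0; rewrite !rmorphM rmorph_nat /=; ring.
by congr (_ + _); rewrite [RHS]mulr_sumr; apply: eq_bigr => t _; rewrite !mulrA.
Qed.

Lemma hat_levelC (P : pred F) a :
  p%:R * hat [set x in ~: A | P (f x)] a =
  #|P|%:R * hat (~: A) a - (a \notin B)%:R * (c%:~R * gauss) * level_kernel P (g a).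
Proof.
rewrite (hat_level_gen (k := fun t => - ((a \notin B)%:R * (c%:~R * gauss) *
  ((eta t)%:~R * chi (rho t * g a))))) => [|t t0]; last first.
  by have [_ ->] := H a t0; rewrite !rmorphN !rmorphM rmorph_nat /=; ring.
congr (_ + _); rewrite [X in _ = - X]mulr_sumr -sumrN; apply: eq_bigr => t _.
by rewrite !mulrA !mulNr.
Qed.

(** For the level 0 the kernel is a Gauss sum in the variable [rho t]; in particular it vanishes at
    [b = 0]. *)
Lemma level_kernel0 b : level_kernel (pred1 0) b = (eta b)%:~R * gauss.
Proof.
rewrite -gauss_mul [RHS](reindex_inj rho_inj) [RHS](bigD1 0) //=.
rewrite rho0 eta0 mul0r add0r; apply: eq_bigr => t _.
by rewrite (big_pred1 0) // mulr0 oppr0 chi0 mulr1 square_twist_eta (mulrC b).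
Qed.

End DualSide.

(** * Two mutually dual sides *)

Section DualPair.

Variables (A B : {set X}) (f g : X -> F) (c c' : int) (rho rho' : F -> F).
Hypotheses (H : dual_side A B f g c rho) (rho_sq : square_twist rho).
Hypotheses (H' : dual_side B A g f c' rho').
Hypothesis c_norm : c%:~R ^+ 2 * p%:R = p%:R ^+ n :> C.
Hypothesis cc' : c%:~R * c'%:~R * gauss ^+ 2 = p%:R ^+ n.
Hypotheses (f0 : f 0 = 0) (g0 : g 0 = 0) (A0 : 0 \in A) (B0 : 0 \in B).

Let p0 : p%:R != 0 :> C.
Proof. by rewrite pnatr_eq0 -lt0n prime_gt0. Qed.

(** Parseval for [chi (f x)] restricted to [A]: its transform has squared modulus p ^ n on [B] and
    vanishes elsewhere. *)
Lemma card_dual : #|B| = #|A|.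
Proof.
have pn0 : p%:R ^+ n != 0 :> C by rewrite expf_neq0.
apply/eqP; rewrite -(eqr_nat C); apply/eqP/(mulfI pn0).
transitivity (p%:R ^+ n *
    \sum_x ((x \in A)%:R * chi (f x)) * ((x \in A)%:R * chi (f x))^* : C);
  last first.
  congr (_ * _); rewrite -sum1_card natr_sum [RHS]big_mkcond /=.
  apply: eq_bigr => x _; rewrite rmorphM /= conj_chi conjC_nat mulrACA -chiD.
  by rewrite subrr chi0 mulr1 -natrM mulnb andbb; case: (x \in A).
rewrite -fourier_parseval -sum1_card natr_sum mulr_sumr [LHS]big_mkcond /=.
apply: eq_bigr => a _.
have -> : \sum_x (x \in A)%:R * chi (f x) * chi (- dotp a x) =
    (a \in B)%:R * (c%:~R * (gauss * chi (rho 1 * g a))).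
  have [+ _] := H a (oner_neq0 _); rewrite eta1 mul1r intrM rmorph_nat -mulrA => <-.
  rewrite [RHS]big_mkcond /=; apply: eq_bigr => x _.
  by rewrite mul1r chiD; case: (x \in A); rewrite ?mul1r ?mul0r.
case: (a \in B); rewrite ?mul0r // !mul1r mulr1 -c_norm -gauss_norm.
rewrite !rmorphM /= rmorph_int conj_chi -[LHS]mulr1 -chi0.
by rewrite -(subrr (rho 1 * g a)) chiD; ring.
Qed.

Lemma card_level0 : (p * #|[set x in A | f x == 0%R]| = #|A|)%N.
Proof.
apply/eqP; rewrite -(eqr_nat C) natrM -hat0 (hat_level H (pred1 0)).
by rewrite card1 mul1r g0 level_kernel0 // eta0 mul0r mulr0 addr0 hat0.
Qed.

(** After [sum_hatC], [hat_level] leaves for each nonzero [t] a sum over [B] which [H'] evaluates at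
    0; each contributes p ^ n. *)
Lemma sum_hat_level0 :
  p%:R * (\sum_(x in A | f x == 0) hat B x) =
  \sum_(a in B) hat A a + p.-1%:R * p%:R ^+ n.
Proof.
transitivity (p%:R * \sum_(x in [set x in A | f x == 0]) hat B x).
  by congr (_ * _); apply: eq_bigl => x; rewrite inE.
rewrite -sum_hatC mulr_sumr; under eq_bigr => a aB.
  rewrite (hat_level H (pred1 0)) card1 mul1r aB mul1r; over.
rewrite big_split /=; congr (_ + _); rewrite -mulr_sumr exchange_big /=.
have cardF : #|[pred j : F | j != 0]| = p.-1.
  by have := cardC1 (0 : F); rewrite card_Fp.
rewrite -cardF -sumr_const mulr_sumr mulr_suml; apply: eq_bigr => t t0.
rewrite (eq_bigr (fun a => (eta t)%:~R * chi (rho t * g a - dotp 0 a))); last first.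
  by move=> a _; rewrite dotp0l subr0 (big_pred1 0) // mulr0 oppr0 chi0 mulr1.
have rt0 : rho t != 0 by rewrite square_twist_eq0.
rewrite -mulr_sumr; have [-> _] := H' 0 rt0.
rewrite A0 mul1r f0 mulr0 chi0 mulr1 square_twist_eta // mul1r -cc' intrM.
transitivity ((eta t)%:~R ^+ 2 * (c%:~R * c'%:~R * gauss ^+ 2)); first by ring.
by rewrite -rmorphXn eta_sqr // mul1r.
Qed.

(* The squared distance between the two sides, summed over [x], vanishes. *)
Lemma hat_dual_level0 r : #|A| = (p ^ r)%N -> (r + r = n.+1)%N ->
  \sum_(a in B) hat A a = p%:R ^+ n ->
  forall x, hat B x = p%:R ^+ r * ((x \in A) && (f x == 0))%:R.
Proof.
move=> cardA rE theta x.
have s0 : \sum_(x in A | f x == 0) hat B x = p%:R ^+ n.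
  apply: (mulfI p0); rewrite sum_hat_level0 theta -{1}[p%:R ^+ n]mul1r -mulrDl.
  by rewrite -[1]/(1%:R) -natrD add1n prednK ?prime_gt0.
pose b x : C := ((x \in A) && (f x == 0))%:R.
have sumb (w : X -> C) : \sum_(x in A | f x == 0) w x = \sum_x b x * w x.
  rewrite big_mkcond; apply: eq_bigr => y _; rewrite /b.
  by case: (_ && _); rewrite ?mul1r ?mul0r.
pose d x := hat B x - p%:R ^+ r * b x.
have dd : \sum_x d x * (d x)^* = 0.
  (* Since [f] has p ^ (r - 1) zeros in [A], the total is p ^ (n + r) - 2 p ^ (n + r) + p ^ (3r -
     1), which is 0 when 2r = n + 1. *)
  transitivity (\sum_x hat B x * (hat B x)^* -
      p%:R ^+ r * \sum_(x in A | f x == 0) hat B x -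
      p%:R ^+ r * (\sum_(x in A | f x == 0) hat B x)^* +
      p%:R ^+ r * p%:R ^+ r * \sum_(x in A | f x == 0) 1).
    rewrite !sumb rmorph_sum !mulr_sumr /= -!sumrB -big_split /=.
    apply: eq_bigr => y _; rewrite /d rmorphB !rmorphM rmorphXn /= !conjC_nat.
    have : b y * b y = b y by rewrite -natrM mulnb andbb.
    rewrite -[(_ && _)%:R]/(b y); move: (b y) (hat B y) => by_ h bb.
    transitivity (h * h^* - p%:R ^+ r * (by_ * h) - p%:R ^+ r * (by_ * h^*)
       + p%:R ^+ r * p%:R ^+ r * (by_ * by_)); first by ring.
    by rewrite bb mulr1.
  rewrite s0 rmorphXn /= conjC_nat hat_parseval card_dual cardA natrX.
  have -> : \sum_(x in A | f x == 0) 1 = #|[set x in A | f x == 0]|%:R :> C.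
    by rewrite -sum1_card natr_sum; apply: eq_bigl => y; rewrite inE.
  have : p%:R * #|[set x in A | f x == 0%R]|%:R = p%:R ^+ r :> C.
    by rewrite -natrM card_level0 cardA natrX.
  have -> : p%:R ^+ r * p%:R ^+ r = p%:R * p%:R ^+ n :> C.
    by rewrite -exprD rE exprS.
  by move=> eN; rewrite (mulrC p%:R) -mulrA eN; ring.
have d_ge0 y : true -> 0 <= d y * (d y)^* by rewrite mul_conjC_ge0.
have /eqP := psumr_eq0P d_ge0 dd (erefl true : xpredT x).
by rewrite mul_conjC_eq0 subr_eq0 => /eqP.
Qed.

End DualPair.

Lemma conv_hat (U V : {set X}) x :
  \sum_a hat U a * hat V a * chi (dotp a x) =
  p%:R ^+ n * #|[set y | (x - y \in U) && (y \in V)]|%:R.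
Proof.
transitivity (\sum_(y in V) \sum_a hat U a * chi (dotp a (x - y))).
  rewrite exchange_big /=; apply: eq_bigr => a _.
  rewrite mulrAC mulr_sumr; apply: eq_bigr => y _.
  by rewrite -mulrA -chiD dotpDr dotpNr.
under eq_bigr do rewrite hat_inv.
rewrite -mulr_sumr; congr (_ * _); rewrite -sum1_card natr_sum.
rewrite big_mkcond [RHS]big_mkcond /=; apply: eq_bigr => y _.
by rewrite inE; case: (x - y \in U); case: (y \in V).
Qed.

(* Compare both sides modulo [y], then modulo [y - 1]. *)
Lemma level0_count_absurd q y w N : (1 < q)%N -> (1 < w)%N -> (q * w <= y)%N ->
  (q ^ 2 * (y + y.-1 * N) = q * y * y + q.-1 * (q * y * w))%N -> False.
Proof.
move=> q1 w1 qwy e.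
have y0 : (0 < y)%N by apply: leq_trans qwy; rewrite muln_gt0; lia.
have e1 : (q * y + y.-1 * (q * N) = y * y + q.-1 * (y * w))%N.
  apply/eqP; rewrite -(eqn_pmul2l (ltnW q1)); apply/eqP.
  transitivity (q ^ 2 * (y + y.-1 * N))%N; [ring | rewrite e; ring].
have /dvdnP[M qN] : (y %| q * N)%N.
  have cop : coprime y y.-1 by rewrite coprime_sym coprimePn.
  rewrite -(Gauss_dvdr _ cop) -(dvdn_addr _ (dvdn_mull q (dvdnn y))) e1.
  by apply: dvdn_add; [exact: dvdn_mulr | exact/dvdn_mull/dvdn_mulr].
have e2 : (q + y.-1 * M = y + q.-1 * w)%N.
  apply/eqP; rewrite -(eqn_pmul2l y0); apply/eqP; move: e1; rewrite qN => e1.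
  transitivity (q * y + y.-1 * (M * y))%N; [ring | rewrite e1; ring].
have qw : (q * w = q.-1 * w + w)%N by rewrite -{1}(prednK (ltnW q1)) mulSn addnC.
(* For [M >= 2] the left side of [e2] is too large, as [q * w <= y]; for [M <= 1] it is too small,
   as [w >= 2]. *)
have [M2|M1] := leqP 2 M.
  have : (y.-1 * 2 <= y.-1 * M)%N by rewrite leq_mul2l M2 orbT.
  by move: e2 qwy; rewrite qw; move: (_ * _)%N (q.-1 * w)%N; lia.
have : (y.-1 * M <= y.-1)%N by case: (M) M1 => [|[|]] // _; rewrite ?muln0 ?muln1.
have : (q.-1 * 2 <= q.-1 * w)%N by rewrite leq_mul2l w1 orbT.
by move: e2; move: (_ * M)%N (q.-1 * w)%N; lia.
Qed.

(** * The case where one side is a subspace *)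

Section SubspaceSide.

Variables (A B : {set X}) (f g : X -> F) (c c' : int) (rho rho' : F -> F) (r : nat).
Hypotheses (H : dual_side A B f g c rho) (rho_sq : square_twist rho).
Hypotheses (H' : dual_side B A g f c' rho') (rho'_sq : square_twist rho').
Hypothesis c_norm : c%:~R ^+ 2 * p%:R = p%:R ^+ n :> C.
Hypothesis cc' : c%:~R * c'%:~R * gauss ^+ 2 = p%:R ^+ n.
Hypotheses (f0 : f 0 = 0) (g0 : g 0 = 0) (f_even : forall x, f (- x) = f x).
Hypotheses (A0 : 0 \in A) (AD : forall x y, x \in A -> y \in A -> x + y \in A).
Hypotheses (AN : forall x, x \in A -> - x \in A) (cardA : #|A| = (p ^ r)%N).

Let p0 : p%:R != 0 :> C.
Proof. by rewrite pnatr_eq0 -lt0n prime_gt0. Qed.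

Let c_neq0 : c%:~R != 0 :> C.
Proof.
apply: contra_eq_neq c_norm => ->.
by rewrite expr0n mul0r eq_sym expf_neq0.
Qed.

Let perp := [set a : X | [forall x in A, dotp a x == 0]].

Lemma hat_subspace a : hat A a = #|A|%:R * (a \in perp)%:R.
Proof.
rewrite inE; case: (boolP [forall x in A, _]) => [/forall_inP aA|].
  rewrite mulr1 -sum1_card natr_sum; apply: eq_bigr => x xA.
  by rewrite (eqP (aA x xA)) oppr0 chi0.
rewrite negb_forall_in => /exists_inP[y yA ay]; rewrite mulr0.
apply/eqP; have: (chi (- dotp a y) - 1) * hat A a = 0.
  rewrite mulrBl mul1r mulr_sumr /hat [X in _ - X](reindex_inj (addrI y)) /=.
  rewrite (eq_bigl (fun x => y + x \in A)) => [|x]; last first.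
    by apply/idP/idP => [/(AD yA)//|/(AD (AN yA))]; rewrite addKr.
  by rewrite -sumrB big1 // => x _; rewrite dotpDr opprD chiD subrr.
by move/eqP; rewrite mulf_eq0 subr_eq0 chi_eq1 oppr_eq0 (negPf ay).
Qed.

Lemma card_perp : (#|A| * #|perp|)%N = (p ^ n)%N.
Proof.
have := hat_inv A 0; rewrite A0 mulr1 => e.
apply/eqP; rewrite -(eqr_nat C) natrX -e natrM -[#|perp|]sum1_card natr_sum mulr_sumr.
rewrite big_mkcond; apply/eqP/eq_bigr => a _ /=.
rewrite hat_subspace dotpC dotp0l chi0 mulr1.
by case: (a \in perp); rewrite ?mulr0.
Qed.

(** Shifting [a] by [w] does not change [dotp a x] on [A], and the sum over [A] determines both
    membership in [B] and the value of [g]. *)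
Lemma dual_perp a w : w \in perp -> a \in B -> (a + w \in B) /\ g (a + w) = g a.
Proof.
rewrite inE => /forall_inP wA aB.
have [e1 _] := H a (oner_neq0 _); have [e2 _] := H (a + w) (oner_neq0 _).
have : \sum_(x in A) chi (1 * f x - dotp a x) =
    \sum_(x in A) chi (1 * f x - dotp (a + w) x).
  by apply: eq_bigr => x xA; rewrite dotpDl (eqP (wA x xA)) addr0.
rewrite e1 e2 aB eta1 !mul1r.
case: (a + w \in B); last first.
  rewrite mul0r mul0r => /eqP; rewrite !mulf_eq0 (negPf c_neq0).
  by rewrite (negPf gauss_neq0) (negPf (chi_neq0 _)).
rewrite mul1r => /(mulfI c_neq0)/(mulfI gauss_neq0)/chi_inj/mulfI -> //.
by rewrite (square_twist_eq0 rho_sq) oner_neq0.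
Qed.

Lemma dual_sym a : a \in B -> - a \in B.
Proof.
move=> aB; have [e1 _] := H a (oner_neq0 _); have [e2 _] := H (- a) (oner_neq0 _).
have : \sum_(x in A) chi (1 * f x - dotp a x) =
    \sum_(x in A) chi (1 * f x - dotp (- a) x).
  rewrite [RHS](reindex_inj oppr_inj) /=; apply: eq_big => x.
    by apply/idP/idP => /AN; rewrite ?opprK.
  by rewrite f_even dotpNl dotpNr opprK.
rewrite e1 e2 aB eta1 !mul1r; case: (- a \in B) => //.
rewrite mul0r mul0r => /eqP; rewrite !mulf_eq0 (negPf c_neq0).
by rewrite (negPf gauss_neq0) (negPf (chi_neq0 _)).
Qed.

(* [B] is stable under negation and has odd cardinality. *)
Lemma dual_mem0 : 0 \in B.
Proof.
rewrite -[_ \in _]negbK; apply/negP => B0.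
have := even_card_sym dual_sym B0.
by rewrite (card_dual H c_norm) cardA oddX p_odd orbT.
Qed.

(** [B] contains [0] and is stable under [perp], so it contains [perp], the support of [hat A]. *)
Lemma sum_hat_subspace : \sum_(a in B) hat A a = p%:R ^+ n.
Proof.
have perpB a : a \in perp -> a \in B.
  by move=> /dual_perp/(_ dual_mem0)[]; rewrite add0r.
rewrite -natrX -card_perp natrM -[#|perp|]sum1_card natr_sum mulr_sumr.
rewrite big_mkcond [RHS]big_mkcond; apply: eq_bigr => a _ /=.
rewrite hat_subspace; case: (boolP (a \in perp)) => [/perpB ->|_] //.
by rewrite mulr0 if_same.
Qed.

Let perp_level0 a : a \in perp -> a \in B /\ g a = 0.
Proof.
by move=> /dual_perp/(_ dual_mem0)[]; rewrite add0r g0.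
Qed.

Let gauss4 : gauss ^+ 2 * gauss ^+ 2 = p%:R ^+ 2.
Proof.
rewrite gauss_sqr mulrACA -expr2 -rmorphXn eta_sqr ?mul1r ?expr2 //.
by rewrite oppr_eq0 oner_neq0.
Qed.

(** The count is an inverse transform of the square of [hat L]. In this square the cross term
    vanishes, as [g] is 0 on [perp], and [eta (g a) ^+ 2] is the indicator of [g a != 0]. The sum
    over the zeros of [g] in [B] is [hat B x / p] by duality, as [f x = 0]. *)
Lemma card_level0_sums x : x \in A -> f x = 0 ->
  p%:R ^+ 2 * #|[set y | (- x - y \in [set v in A | f v == 0]) &&
                        (y \in [set v in A | f v == 0])]|%:R =
  #|A|%:R + p.-1%:R * hat B x :> C.
Proof.
move=> xA fx; set L := [set v in A | f v == 0].
have pn0 : p%:R ^+ n != 0 :> C by rewrite expf_neq0.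
apply: (mulfI pn0); rewrite mulrCA -conv_hat mulr_sumr.
have hatL a :
    p%:R * hat L a = hat A a + (a \in B)%:R * (c%:~R * gauss ^+ 2) * (eta (g a))%:~R.
  rewrite (hat_level H (pred1 0)) card1 mul1r level_kernel0 //; congr (_ + _); ring.
have hatL2 a : p%:R ^+ 2 * (hat L a * hat L a) =
    #|A|%:R ^+ 2 * (a \in perp)%:R +
    p%:R ^+ n * p%:R * ((a \in B)%:R - ((a \in B) && (g a == 0))%:R).
  transitivity ((p%:R * hat L a) ^+ 2); first by ring.
  rewrite hatL hat_subspace; case: (boolP (a \in perp)) => [/perp_level0[-> ->]|_].
    by rewrite eta0 eqxx /=; ring.
  case: (a \in B); last by rewrite /=; ring.
  rewrite !mulr0 mul1r !add0r exprMn exprMn [_ ^+ 2 ^+ 2]expr2 gauss4.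
  have [->|ga] := eqVneq (g a) 0; first by rewrite eta0; ring.
  have -> : (eta (g a))%:~R ^+ 2 = 1 :> C by rewrite -rmorphXn eta_sqr.
  by rewrite /= -c_norm; ring.
transitivity (#|A|%:R ^+ 2 * \sum_a (a \in perp)%:R * chi (dotp a (- x)) +
   p%:R ^+ n * p%:R * (\sum_a (a \in B)%:R * chi (dotp a (- x)) -
     \sum_a ((a \in B) && (g a == 0))%:R * chi (dotp a (- x)))).
  rewrite -sumrB !mulr_sumr -big_split; apply: eq_bigr => a _ /=.
  by rewrite [LHS]mulrA hatL2; ring.
have -> : \sum_a (a \in perp)%:R * chi (dotp a (- x)) = #|perp|%:R.
  rewrite -sum1_card natr_sum [RHS]big_mkcond; apply: eq_bigr => a _ /=.
  case: (boolP (a \in perp)) => [|_]; last by rewrite mul0r.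
  by rewrite inE => /forall_inP/(_ x xA)/eqP ax; rewrite mul1r dotpNr ax oppr0 chi0.
have -> : \sum_a (a \in B)%:R * chi (dotp a (- x)) = hat B x.
  rewrite /hat [RHS]big_mkcond; apply: eq_bigr => a _ /=.
  by rewrite dotpNr dotpC; case: (a \in B); rewrite ?mul1r ?mul0r.
have -> : \sum_a ((a \in B) && (g a == 0))%:R * chi (dotp a (- x)) = hat B x / p%:R.
  apply: (mulfI p0); rewrite mulrCA divff // mulr1.
  transitivity (p%:R * hat [set v in B | g v == 0] x).
    congr (_ * _); rewrite /hat [RHS]big_mkcond; apply: eq_bigr => a _ /=.
    by rewrite inE dotpNr dotpC; case: (_ && _); rewrite ?mul1r ?mul0r.
  rewrite (hat_level H' (pred1 0)) card1 mul1r fx level_kernel0 //.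
  by rewrite eta0 mul0r mulr0 addr0.
have -> : p%:R ^+ n = #|A|%:R * #|perp|%:R :> C by rewrite -natrM card_perp natrX.
have -> : p.-1%:R = p%:R - 1 :> C by rewrite -subn1 natrB ?prime_gt0.
by field.
Qed.

(* By [card_level0_sums] the counts determine [hat B] on [L], and
   [sum_hat_level0] prescribes its sum there; a constant value off 0 would have
   to satisfy the equation refuted in [level0_count_absurd]. *)
Lemma level0_block_dim (L := [set v in A | f v == 0]) N :
  (r < n)%N -> (n.+1 < r + r)%N ->
  ~ (forall x, x \in L :\ 0 ->
      #|[set y | (x - y \in L :\ 0) && (y \in L :\ 0)]| = N).
Proof.
move=> lt_rn lt_n2r cstN.
have L0 : 0 \in L by rewrite inE A0 f0 eqxx.
have LN x : x \in L -> - x \in L by rewrite !inE => /andP[/AN -> ]; rewrite f_even.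
pose M x := #|[set y | (- x - y \in L) && (y \in L)]|.
have M0 : M 0 = #|L|.
  apply: eq_card => y; rewrite inE oppr0 add0r andb_idl //; exact: LN.
(* Allowing 0 in both factors adds exactly two solutions, y = 0 and y = - x. *)
have MN x : x \in L :\ 0 -> M x = N.+2.
  rewrite 2!inE => /andP[x0 xL]; have Nx0 : - x != 0 by rewrite oppr_eq0.
  have NxL : - x \in L :\ 0 by rewrite 2!inE Nx0 LN.
  rewrite -(cstN _ NxL) /M (cardsD1 0) inE subr0 LN // L0 add1n; congr _.+1.
  rewrite [LHS](cardsD1 (- x)) in_setD1 Nx0 in_set subrr L0 LN // add1n; congr _.+1.
  apply: eq_card => y; rewrite !(in_setD1, in_set (fun _ => _ && _)).
  by rewrite subr_eq0 [- x == y]eq_sym; case: (y == 0); case: (y == - x); rewrite ?andbF.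
have cardL : (p * #|L|)%N = #|A| := card_level0 H rho_sq g0.
have s0 : \sum_(x in A | f x == 0) hat B x = p%:R ^+ n.
  apply: (mulfI p0); rewrite (sum_hat_level0 H rho_sq H') ?sum_hat_subspace //.
  by rewrite -{1}[p%:R ^+ n]mul1r -mulrDl -[1]/(1%:R) -natrD add1n prednK ?prime_gt0.
have sumM : (p ^ 2 * (#|L| + #|L|.-1 * N.+2) = #|A| * #|L| + p.-1 * p ^ n)%N.
  apply/eqP; rewrite -(eqr_nat C) natrM.
  have -> : (#|L| + #|L|.-1 * N.+2)%N = (\sum_(x in L) M x)%N.
    rewrite (bigD1 0) //= M0 (eq_bigl (fun x => x \in L :\ 0)) => [|x]; last first.
      by rewrite in_setD1 andbC.
    rewrite (eq_bigr (fun=> N.+2)) => [|x xL]; last exact: MN.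
    by rewrite sum_nat_const (cardsD1 0 L) L0.
  rewrite natr_sum natrX mulr_sumr.
  under eq_bigr => x xL.
    move: (xL); rewrite inE => /andP[xA /eqP fx].
    rewrite (card_level0_sums xA fx); over.
  rewrite big_split sumr_const /= -mulr_sumr natrD !natrM natrX -mulr_natr.
  rewrite (eq_bigl (fun x => (x \in A) && (f x == 0))) => [|x]; last by rewrite inE.
  by rewrite s0 -[_ *+ #|L|]mulr_natr.
have r0 : (0 < r)%N by rewrite lt0n; apply: contraTneq lt_n2r => ->.
have cardL' : #|L| = (p ^ r.-1)%N.
  apply/eqP; rewrite -(eqn_pmul2l (prime_gt0 p_pr)) cardL cardA.
  by rewrite -{1}(prednK r0) expnS.
have w1 : (1 < p ^ (n - r))%N by rewrite -{1}(expn0 p) ltn_exp2l ?prime_gt1 ?subn_gt0.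
have wL : (p * p ^ (n - r) <= #|L|)%N.
  rewrite cardL' -expnS leq_exp2l ?prime_gt1 //.
  by clear - lt_rn lt_n2r r0; lia.
(* Here [q] is [p], [y] is #|L| = p ^ (r - 1), and [w] is p ^ (n - r). *)
apply: (level0_count_absurd (prime_gt1 p_pr) w1 wL (N := N.+2)).
have pn : (p ^ n = #|A| * p ^ (n - r))%N by rewrite cardA -expnD subnKC ?(ltnW lt_rn).
by rewrite sumM cardL pn.
Qed.

End SubspaceSide.

(** * Partitions into level sets *)

Section Labels.

Variables (T : finType) (q : F -> T).

Definition label (A : {set X}) (f : X -> F) (x : X) : bool * bool * T :=
  (x == 0, x \in A, q (f x)).

(* For [q := id] this is the partition P of the statement, for
   [q := quadratic_class] it is D. *)
Definition level_blocks (A : {set X}) (f : X -> F) : {set {set X}} :=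
  ([set [set 0]] :|: [set [set x in A | q (f x) == l] :\ 0 | l : T]
     :|: [set [set x in ~: A | q (f x) == l] :\ 0 | l : T]) :\ set0.

Lemma level_blocksC A f : level_blocks (~: A) f = level_blocks A f.
Proof. by rewrite /level_blocks setCK setUAC. Qed.

Lemma label_fiber A f x : [set y | label A f y == label A f x] =
  if x == 0 then [set 0] else
  if x \in A then [set y in A | q (f y) == q (f x)] :\ 0
  else [set y in ~: A | q (f y) == q (f x)] :\ 0.
Proof.
apply/setP => y; rewrite inE /label !xpair_eqE.
have [->|x0] := eqVneq x 0.
  by rewrite inE eqb_id; case: eqP => [->|//]; rewrite !eqxx.
rewrite eqbF_neg; case: (x \in A); rewrite !inE.
  by rewrite eqb_id andbA.
by rewrite eqbF_neg andbA.
Qed.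

Lemma label_fiber_block A f x : [set y | label A f y == label A f x] \in level_blocks A f.
Proof.
rewrite in_setD1; apply/andP; split.
  by apply/set0Pn; exists x; rewrite inE.
rewrite label_fiber; case: ifP => _; first by rewrite !inE eqxx.
case: ifP => _; apply/setUP; [left; apply/setUP|]; right; apply/imsetP.
  by exists (q (f x)).
by exists (q (f x)).
Qed.

Lemma block_label_fiber A f U : U \in level_blocks A f ->
  exists x, U = [set y | label A f y == label A f x].
Proof.
rewrite in_setD1 => /andP[/set0Pn[x xU]]; rewrite !in_setU => /orP[/orP[]|].
- by rewrite inE => /eqP ->; exists 0; rewrite label_fiber eqxx.
- case/imsetP=> l _ UE; exists x; move: xU; rewrite UE label_fiber !inE.
  by case/andP => /negPf-> /andP[-> /eqP ->].
- case/imsetP=> l _ UE; exists x; move: xU; rewrite UE label_fiber !inE.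
  by case/andP => /negPf-> /andP[/negPf-> /eqP ->].
Qed.

(** The condition under which the kernel in [hat_level] sees [g a] only through its class
    [q (g a)]. *)
Definition kernel_compatible (rho : F -> F) := forall l b b', q b = q b' ->
  level_kernel rho (fun j => q j == l) b = level_kernel rho (fun j => q j == l) b'.

(** Every ingredient of [hat_level] and [hat_levelC] is a function of the label of [a]: [hat A] by
    its explicit form, the indicator of [B], and the kernel by compatibility. The complement also
    uses whether [a] is 0, through [hatC]. *)
Lemma hat_label A B f g c rho (k : C) : dual_side A B f g c rho ->
  kernel_compatible rho -> (forall b, q b = q 0 -> b = 0) ->
  (forall a, hat A a = k * ((a \in B) && (g a == 0))%:R) ->
  forall l a b, label B g a = label B g b ->
  hat [set x | label A f x == l] a = hat [set x | label A f x == l] b.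
Proof.
move=> H compat q0 hatA l a b [eq0 eqB eqg].
have p0 : p%:R != 0 :> C by rewrite pnatr_eq0 -lt0n prime_gt0.
have eqg0 : (g a == 0) = (g b == 0).
  by apply/eqP/eqP => e; apply: q0; rewrite -e.
have eqA : hat A a = hat A b by rewrite !hatA eqB eqg0.
have eqL (l' : T) (S : {set X}) : S = A \/ S = ~: A ->
    hat [set x in S | q (f x) == l'] a = hat [set x in S | q (f x) == l'] b.
  case=> ->; apply: (mulfI p0).
    rewrite !(hat_level H (fun j => q j == l')) eqA eqB; congr (_ + _ * _).
    exact: compat.
  rewrite !(hat_levelC H (fun j => q j == l')) !hatC eqA eqB eq0; congr (_ - _ * _).
  exact: compat.
have hatD1 (S : {set X}) e : hat (S :\ 0) e = hat S e - (0 \in S)%:R.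
  rewrite /hat; case: (boolP (0 \in S)) => [S0|S0]; last first.
    rewrite subr0; apply: eq_bigl => x; rewrite in_setD1 andb_idl //.
    by apply: contraTneq => ->.
  rewrite [in RHS](bigD1 0) //= dotpC dotp0l oppr0 chi0 addrAC subrr add0r.
  by apply: eq_bigl => x; rewrite in_setD1 andbC.
have [/existsP[x /eqP <-]|] := boolP [exists x, label A f x == l]; last first.
  rewrite negb_exists => /forallP nl; rewrite /hat !big1 // => x;
  by rewrite inE (negPf (nl x)).
rewrite label_fiber; case: ifP => _.
  by rewrite /hat !big_set1 !(dotpC _ 0) !dotp0l.
by case: ifP => _; rewrite !hatD1 eqL; auto.
Qed.

(* The two partitions by labels are dual to each other. *)
Lemma label_count A B f g :
  (forall l a b, label B g a = label B g b ->
     hat [set x | label A f x == l] a = hat [set x | label A f x == l] b) ->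
  (forall l x y, label A f x = label A f y ->
     hat [set a | label B g a == l] x = hat [set a | label B g a == l] y) ->
  (forall x, label A f (- x) = label A f x) ->
  forall u v x y, label A f x = label A f y ->
  #|[set w | (label A f (x - w) == u) && (label A f w == v)]| =
  #|[set w | (label A f (y - w) == u) && (label A f w == v)]|.
Proof.
move=> hatA hatB labN u v x y lxy.
have pn0 : p%:R ^+ n != 0 :> C by rewrite expf_neq0 // pnatr_eq0 -lt0n prime_gt0.
pose U l := [set t | label A f t == l].
have cntE t : p%:R ^+ n * #|[set w | (label A f (t - w) == u) && (label A f w == v)]|%:R =
    \sum_a hat (U u) a * hat (U v) a * chi (dotp a t).
  rewrite conv_hat; congr (_ * _%:R); apply: eq_card => w.
  by rewrite !inE.
apply/eqP; rewrite -(eqr_nat C); apply/eqP/(mulfI pn0).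
(* On the [a] with a given label both transforms are constant; what remains is the transform of a
   block of the dual partition. *)
rewrite !cntE [LHS](partition_big (label B g) xpredT) //.
rewrite [RHS](partition_big (label B g) xpredT) //=; apply: eq_bigr => l _.
have [/existsP[a0 /eqP la0]|] := boolP [exists a, label B g a == l]; last first.
  rewrite negb_exists => /forallP nl.
  by rewrite !big_pred0 // => a; rewrite (negPf (nl a)).
have sumE t : \sum_(a | label B g a == l) hat (U u) a * hat (U v) a * chi (dotp a t) =
    hat (U u) a0 * hat (U v) a0 * hat [set a | label B g a == l] (- t).
  rewrite /hat [RHS]mulr_sumr -/(hat _ _); apply: eq_big => [a|a /eqP la].
    by rewrite inE.
  rewrite -!/(hat _ _) (hatA u a a0) ?(hatA v a a0) ?la ?la0 //.
  by rewrite dotpNl opprK dotpC.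
by rewrite !sumE (hatB l (- x) (- y)) // !labN.
Qed.

Lemma level_blocks_scheme A f :
  (forall x, label A f (- x) = label A f x) ->
  (forall u v x y, label A f x = label A f y ->
  #|[set w | (label A f (x - w) == u) && (label A f w == v)]| =
  #|[set w | (label A f (y - w) == u) && (label A f w == v)]|) ->
  induces_symmetric_scheme (level_blocks A f).
Proof.
move=> labN cnt; apply: (@fibers_symmetric_scheme _ _ (label A f)) => //.
- exact: block_label_fiber.
- exact: label_fiber_block.
- have := label_fiber_block A f 0; rewrite label_fiber eqxx; exact.
Qed.

Lemma level_blocks_scheme_dim A B f g c c' rho rho' r :
  dual_side A B f g c rho -> square_twist rho -> kernel_compatible rho ->
  dual_side B A g f c' rho' -> square_twist rho' -> kernel_compatible rho' ->
  (forall b, q b = q 0 -> b = 0) ->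
  c%:~R ^+ 2 * p%:R = p%:R ^+ n :> C -> c'%:~R ^+ 2 * p%:R = p%:R ^+ n :> C ->
  c%:~R * c'%:~R * gauss ^+ 2 = p%:R ^+ n ->
  f 0 = 0 -> g 0 = 0 -> (forall x, f (- x) = f x) -> (forall x, g (- x) = g x) ->
  0 \in A -> (forall x y, x \in A -> y \in A -> x + y \in A) ->
  (forall x, x \in A -> - x \in A) -> #|A| = (p ^ r)%N ->
  (r < n)%N -> odd n -> ((n + 1) %/ 2 <= r)%N ->
  induces_symmetric_scheme (level_blocks A f) <-> r = ((n + 1) %/ 2)%N.
Proof.
move=> H sq cmp H' sq' cmp' q0 cN c'N cc' f0 g0 f_even g_even A0 AD AN cardA.
move=> lt_rn odd_n le_nr.
have n2 : n.+1 = (((n + 1) %/ 2) * 2)%N.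
  by rewrite addn1 divnK // dvdn2 /= odd_n.
have B0 : 0 \in B.
  exact: (dual_mem0 H cN f_even AN cardA).
have theta : \sum_(a in B) hat A a = p%:R ^+ n.
  exact: (sum_hat_subspace H sq cN f_even A0 AD AN cardA).
split=> [sch|rE].
  apply/eqP; rewrite eqn_leq le_nr andbT leqNgt; apply/negP => lt_nr.
  pose L := [set x in A | f x == 0].
  have LE : [set x in A | q (f x) == q 0] = L.
    by apply/setP => x; rewrite !inE; congr andb; apply/eqP/eqP => [/q0|->].
  have lt_n2r : (n.+1 < r + r)%N by rewrite n2; clear - lt_nr; lia.
  suff [N cstN] : exists N, forall x, x \in L :\ 0 ->
      #|[set y | (x - y \in L :\ 0) && (y \in L :\ 0)]| = N.
    exact: (level0_block_dim H sq H' sq' cN cc' f0 g0 f_even A0 AD AN cardA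
      lt_rn lt_n2r cstN).
  (* Empty blocks are discarded from the partition; for an empty one any [N] will do. *)
  have [->|L0] := eqVneq (L :\ 0) set0; first by exists 0%N => x; rewrite inE.
  apply: (scheme_count sch); rewrite in_setD1 L0 -LE !in_setU.
  by rewrite (imset_f (fun l => [set x in A | q (f x) == l] :\ 0)) ?orbT.
have rr : (r + r = n.+1)%N by rewrite n2 -rE addnn muln2.
have c'c : c'%:~R * c%:~R * gauss ^+ 2 = p%:R ^+ n by rewrite -cc'; ring.
have cardB : #|B| = (p ^ r)%N by rewrite (card_dual H cN).
have hatB := hat_dual_level0 H sq H' cN cc' f0 g0 A0 cardA rr theta.
(* The sum condition is symmetric in the two sides by [sum_hatC], so their roles can be
   exchanged. *)
have hatA : forall a, hat A a = p%:R ^+ r * ((a \in B) && (g a == 0))%:R.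
  apply: (hat_dual_level0 H' sq' H c'N c'c g0 f0 B0 cardB rr).
  by rewrite -sum_hatC.
have labN x : label A f (- x) = label A f x.
  rewrite /label oppr_eq0 f_even; congr (_, _, _).
  by apply/idP/idP => /AN; rewrite ?opprK.
apply: level_blocks_scheme => //; apply: (label_count (B := B) (g := g)) => //.
  exact: hat_label H cmp q0 hatA.
exact: hat_label H' cmp' q0 hatB.
Qed.

End Labels.

(** * Quadratic classes *)

Definition quadratic_class (j : F) : option bool :=
  if j == 0 then None else Some [exists y, j == y ^+ 2].

Lemma quadratic_class_eq0 b : quadratic_class b = quadratic_class 0 -> b = 0.
Proof. by rewrite /quadratic_class eqxx; case: eqP. Qed.

Lemma quadratic_class_sqr b v : v != 0 ->
  quadratic_class (b * v ^+ 2) = quadratic_class b.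
Proof.
move=> v0; rewrite /quadratic_class mulf_eq0 expf_eq0 (negPf v0) /= orbF.
case: ifP => // _; congr Some; apply/existsP/existsP => -[y /eqP e].
  by exists (y / v); rewrite exprMn -e exprVn mulfK // expf_neq0.
by exists (y * v); rewrite exprMn -e.
Qed.

Lemma kernel_compatible_id rho : kernel_compatible id rho.
Proof. by move=> l b b' ->. Qed.

(** With [b' = b * s ^+ 2], the substitution [phi] absorbs s ^ 2 into [t]. Since
    [phi t = t * v ^+ 2], the change of multiplier is absorbed by [j * v ^+ 2], which permutes each
    class. *)
Lemma kernel_compatible_quadratic rho : square_twist rho ->
  kernel_compatible quadratic_class rho.
Proof.
move=> sq l b b' eq_b; have [rho_inj rho0 rho_sq] := sq.
have [b0|b0] := eqVneq b 0.
  by move: eq_b; rewrite b0 => /esym/quadratic_class_eq0 ->.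
have [s s0 ->] : exists2 s, s != 0 & b' = b * s ^+ 2.
  have b'0 : b' != 0.
    by apply: contra_neq b0 => b'0; apply: quadratic_class_eq0; rewrite eq_b b'0.
  move: eq_b; rewrite /quadratic_class (negPf b0) (negPf b'0) => -[].
  exact: Fp_sqr_classes.
pose phi t := invF rho_inj (rho t * s ^- 2).
have rho_phi t : rho (phi t) = rho t * s ^- 2 by rewrite f_invF.
have s2 : s ^- 2 != 0 by rewrite invr_eq0 expf_neq0.
have phi_inj : injective phi.
  move=> t t' /(congr1 rho); rewrite !rho_phi => /(mulIf s2); exact: rho_inj.
have phi0 t : (phi t != 0) = (t != 0).
  rewrite -(square_twist_eq0 sq (phi t)) rho_phi mulf_eq0 (negPf s2) orbF.
  by rewrite (square_twist_eq0 sq).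
rewrite /level_kernel [RHS](reindex_inj phi_inj) /=.
rewrite [RHS](eq_bigl _ _ phi0); apply: eq_bigr => t t0.
have pt0 : phi t != 0 by rewrite phi0.
have rp : rho (phi t) * (b * s ^+ 2) = rho t * b.
  by rewrite rho_phi; field.
rewrite rp -[eta (phi t)](square_twist_eta sq) rho_phi.
rewrite -exprVn eta_mul_sqr ?invr_eq0 // (square_twist_eta sq); congr (_ * _).
have [v v0 phiE] : exists2 v, v != 0 & phi t = t * v ^+ 2.
  have [v1 v10 e1] := rho_sq _ pt0; have [v2 v20 e2] := rho_sq _ t0.
  exists (v2 / s / v1); first by rewrite !mulf_neq0 ?invr_eq0.
  have : phi t * v1 ^+ 2 = t * v2 ^+ 2 * s ^- 2 by rewrite -e1 rho_phi e2.
  move=> e; apply: (mulIf (expf_neq0 2 v10)).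
  rewrite e -[RHS]mulrA -exprMn divfK // exprMn exprVn.
  by rewrite -[LHS]mulrA.
have vv_inj : injective (fun j => j * (v ^+ 2)) by apply: mulIf; rewrite expf_neq0.
rewrite [LHS](reindex_inj vv_inj) /=; apply: eq_big => j.
  by rewrite quadratic_class_sqr.
by move=> _; rewrite phiE; congr (chi _); ring.
Qed.

End LevelSchemes.

End CyclotomicIntegers.

(** * The partitions P and D *)

Lemma xiX (R : realType) (p k : nat) :
  xi R p ^+ k = Complex (cos (k%:R * (2 * pi / p%:R))) (sin (k%:R * (2 * pi / p%:R))).
Proof.
rewrite /xi; move: (2 * pi / _) => t.
elim: k => [|k IH]; first by rewrite expr0 mul0r cos0 sin0.
rewrite exprS IH -[k.+1%:R]natr1 mulrDl mul1r cosD sinD.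
by apply/eqP; rewrite eq_complex /=; apply/andP; split; apply/eqP; ring.
Qed.

(** The order divides the prime [p], and it is not 1 because the angle lies strictly between 0 and
    [pi], where the sine is positive. *)
Lemma xi_prim (R : realType) (p : nat) : prime p -> odd p ->
  p.-primitive_root (xi R p).
Proof.
move=> p_pr p_odd; have p0 : p%:R != 0 :> R by rewrite pnatr_eq0 -lt0n prime_gt0.
have p_gt0 : 0 < p%:R :> R by rewrite ltr0n prime_gt0.
have xip : xi R p ^+ p = 1.
  rewrite xiX mulrC divfK // mulrC mulr_natr cos2pi sin2pi.
  by apply/eqP; rewrite eq_complex /= !eqxx.
have [m m_prim m_dvd] := prim_order_exists (prime_gt0 p_pr) xip.
case/primeP: (p_pr) => _ /(_ m m_dvd) /orP[] /eqP mE; last by rewrite -{1}mE.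
have : xi R p = 1 by rewrite -[LHS]expr1 -mE prim_expr_order.
rewrite /xi => /eqP; rewrite eq_complex /= => /andP[_ /eqP s0].
have : 0 < sin (2 * pi / p%:R) :> R.
  apply: sin_gt0_pi; rewrite divr_gt0 ?mulr_gt0 ?pi_gt0 //= ltr_pdivrMr //.
  rewrite mulrC ltr_pM2l ?pi_gt0 // ltr_nat.
  by have := prime_gt1 p_pr; case: (p) p_odd => [|[|[]]].
by rewrite s0 ltxx.
Qed.

(** * Walsh transforms and sign classes over [R[i]] *)

Section DualBent.

Variables (R : realType) (p n m : nat).
Hypotheses (p_pr : prime p) (p_odd : odd p) (nE : n = (m + m).+1).
Local Notation F := 'F_p.
Local Notation X := 'rV[F]_n.
Local Notation z := (xi R p).

Let z_prim : p.-primitive_root z := xi_prim R p_pr p_odd.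

(** For [n] odd, p ^ n is congruent to p modulo 4, so the square of [mu] is [eta (- 1)]. *)
Lemma mu_pn2_sqr : (mu R p n * pn2 R p n) ^+ 2 = (eta (- 1 : F))%:~R * p%:R ^+ n.
Proof.
rewrite exprMn sqrtCK; congr (_ * _); rewrite (etaN1 p_pr p_odd) /mu.
have p4 : (p %% 4 == 1)%N = ~~ odd p./2.
  by move: p_odd; rewrite -{3}(odd_double_half p) => ->; lia.
have -> : (p ^ n %% 4 = p %% 4)%N.
  have p2 : (p ^ 2 = 1 %[mod 4])%N.
    rewrite -[in LHS](odd_double_half p) p_odd -muln2.
    have -> : ((true + p./2 * 2) ^ 2 = 1 + (p./2 ^ 2 + p./2) * 4)%N by rewrite /=; ring.
    by rewrite addnC modnMDl.
  by rewrite nE addnn -mul2n expnSr expnM -modnMml -modnXm p2 modnXm exp1n modnMml mul1n.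
rewrite p4 rmorph_sign -signr_odd; case: (odd _); rewrite /= ?expr1n //.
by rewrite expr1 sqr_i.
Qed.

(** Only squares are compared, so the sign of the Gauss sum stays undetermined as [e]; it merely
    decides which sign class is called B_+. *)
Lemma mu_pn2E : exists e : bool,
  mu R p n * pn2 R p n = ((-1) ^+ e * p%:Z ^+ m)%:~R * gauss p z.
Proof.
have : (mu R p n * pn2 R p n) ^+ 2 = ((p%:Z ^+ m)%:~R * gauss p z) ^+ 2.
  rewrite mu_pn2_sqr exprMn gauss_sqr // mulrCA; congr (_ * _).
  by rewrite rmorphXn /= nE exprSr exprD expr2.
move/eqP; rewrite eqf_sqr => /orP[] /eqP ->.
  by exists false; rewrite expr0 mul1r.
by exists true; rewrite expr1 mulN1r rmorphN mulNr.
Qed.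

Lemma walshE (f : X -> F) a : walsh R f a = chi_walsh z f a.
Proof. by []. Qed.

Lemma bent_norm (f : X -> F) : bent R f ->
  forall a, chi_walsh z f a * (chi_walsh z f a)^* = p%:R ^+ n.
Proof.
by move=> fB a; rewrite -normCK -walshE fB sqrtCK.
Qed.

Let signed_eq (s e : bool) (b j : F) :
  (((-1) ^+ s * p%:Z ^+ m)%:~R * (gauss p z * chi z b) ==
   ((-1) ^+ e * p%:Z ^+ m)%:~R * gauss p z * z ^+ j) = (s == e) && (b == j).
Proof.
apply/eqP/andP => [|[/eqP-> /eqP->]]; last by rewrite mulrA.
have K0 : (p%:Z ^+ m)%:~R * gauss p z != 0.
  by rewrite mulf_neq0 ?gauss_neq0 // intr_eq0 expf_neq0 // eqz_nat -lt0n prime_gt0.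
rewrite !rmorphM !rmorph_sign /= => eq_se.
have /(sign_chi_inj p_pr p_odd z_prim)[-> ->] : (-1) ^+ s * chi z b = (-1) ^+ e * chi z j.
  apply: (mulfI K0); transitivity ((-1) ^+ s * (p%:Z ^+ m)%:~R * (gauss p z * chi z b)).
    by ring.
  by rewrite eq_se /chi; ring.
by rewrite !eqxx.
Qed.

Let opp_signed (e : bool) :
  - ((-1) ^+ e * p%:Z ^+ m)%:~R = ((-1) ^+ (~~ e) * p%:Z ^+ m)%:~R :> R[i].
Proof. by rewrite signrN mulNr rmorphN. Qed.

Lemma dualE (f g : X -> F) s : signed_dual z m f s g -> dual R f = g.
Proof.
move=> fg; apply/funext => a; rewrite /dual.
have [e eE] := mu_pn2E.
have gE (j : F) : (walsh R f a == mu R p n * pn2 R p n * xi R p ^+ j) ||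
    (walsh R f a == - (mu R p n * pn2 R p n * xi R p ^+ j)) = (j == g a).
  rewrite eE walshE fg -!mulNr opp_signed !signed_eq -andb_orl eq_sym.
  by case: (s a); case: (e).
by case: pickP => [j|/(_ (g a))]; rewrite gE ?eqxx // => /eqP.
Qed.

Lemma Bplus_Bminus (f g : X -> F) s : signed_dual z m f s g ->
  exists e : bool, Bplus R f = [set a | s a == e] /\ Bminus R f = [set a | s a == ~~ e].
Proof.
move=> fg; have [e eE] := mu_pn2E; exists e.
split; apply/setP => a; rewrite !inE (dualE fg) eE walshE fg.
  by rewrite signed_eq eqxx andbT.
by rewrite -!mulNr opp_signed signed_eq eqxx andbT.
Qed.

End DualBent.

Lemma PpartE (R : realType) (p n : nat) (f : 'rV['F_p]_n -> 'F_p) :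
  f 0 = 0 -> Bminus R (dual R f) = ~: Bplus R (dual R f) ->
  Ppart R f = level_blocks id (Bplus R (dual R f)) f.
Proof.
move=> f0 BC; rewrite /Ppart /level_blocks /dset BC -/(cset R f); congr (_ :\ set0).
(* As [f 0 = 0], the point 0 can only lie in the level 0, and removing it from another level changes
   nothing. *)
have levD1 (S : {set 'rV['F_p]_n}) j : j != 0 ->
    [set x in S | f x == j] :\ 0 = [set x in S | f x == j].
  move=> j0; apply/setP => x; rewrite !inE andb_idl // => /andP[_ /eqP fx].
  by apply: contra_neq j0 => x0; rewrite -fx x0.
have levs (S : {set 'rV['F_p]_n}) :
    [set [set x in S | f x == l] :\ 0 | l : 'F_p] =
    ([set x in S | f x == 0%R] :\ 0%R) |:
      [set [set x in S | f x == l] | l : 'F_p & l != 0].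
  apply/setP => U; rewrite in_setU1; apply/imsetP/orP => [[l _ ->]|[/eqP ->|/imsetP[l]]].
  - have [->|l0] := eqVneq l 0; [by left | right; rewrite levD1 //].
    by apply/imsetP; exists l => //; rewrite inE.
  - by exists 0.
  - by rewrite inE => l0 ->; exists l; rewrite ?levD1.
rewrite !levs; apply/setP => U; rewrite /cset !in_setU !in_set1.
by case: (U == _); case: (U == _); case: (U == _); case: (U \in _); case: (U \in _).
Qed.

Lemma DpartE (R : realType) (p n : nat) (f : 'rV['F_p]_n -> 'F_p) :
  f 0 = 0 -> Bminus R (dual R f) = ~: Bplus R (dual R f) ->
  Dpart R f = level_blocks (@quadratic_class p) (Bplus R (dual R f)) f.
Proof.
move=> f0 BC; rewrite /Dpart /level_blocks /dset BC; congr (_ :\ set0).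
have levs (S : {set 'rV['F_p]_n}) :
    [set [set x in S | quadratic_class (f x) == l] :\ 0 | l : option bool] =
    [set [set x in S | f x == 0] :\ 0; \bigcup_(i in SQ p) [set x in S | f x == i];
      \bigcup_(i in NSQ p) [set x in S | f x == i]].
  have lev0 : [set x in S | quadratic_class (f x) == None] = [set x in S | f x == 0].
    by apply/setP => x; rewrite !inE /quadratic_class; case: (f x == 0).
  have levT : [set x in S | quadratic_class (f x) == Some true] :\ 0 =
      \bigcup_(i in SQ p) [set x in S | f x == i].
    apply/setP => x; rewrite !inE; apply/idP/bigcupP => [/and3P[_ xS]|[j]].
      rewrite /quadratic_class; have [_ //|fx0] := eqVneq (f x) 0.
      case: (boolP [exists y, f x == y ^+ 2]) => // sq _.
      by exists (f x); rewrite !inE ?xS ?sq ?eqxx ?andbT.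
    rewrite !inE => /andP[j0 sq] /andP[-> /eqP fx].
    rewrite /quadratic_class fx (negPf j0) sq eqxx !andbT.
    by apply: contra_neq j0 => x0; rewrite -fx x0.
  have levF : [set x in S | quadratic_class (f x) == Some false] :\ 0 =
      \bigcup_(i in NSQ p) [set x in S | f x == i].
    apply/setP => x; rewrite !inE; apply/idP/bigcupP => [/and3P[_ xS]|[j]].
      rewrite /quadratic_class; have [_ //|fx0] := eqVneq (f x) 0.
      case: (boolP [exists y, f x == y ^+ 2]) => // sq _.
      by exists (f x); rewrite !inE ?xS ?sq ?eqxx ?andbT.
    rewrite !inE => /andP[j0 /negPf sq] /andP[-> /eqP fx].
    rewrite /quadratic_class fx (negPf j0) sq eqxx !andbT.
    by apply: contra_neq j0 => x0; rewrite -fx x0.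
  rewrite -levT -levF -lev0; apply/setP => U; rewrite !inE.
  apply/imsetP/idP => [[l _ ->] |]; first by case: l => [[] |]; rewrite eqxx ?orbT.
  case/orP=> [/orP[]|] /eqP ->.
  - by exists None.
  - by exists (Some true).
  - by exists (Some false).
rewrite !levs; apply/setP => U; rewrite /cset !inE.
by rewrite !orbA.
Qed.

Lemma level_blocks_scheme_iff (R : realType) (p m n : nat) (f g : 'rV['F_p]_n -> 'F_p)
    s t (e : bool) (T : finType) (q : 'F_p -> T) r :
  prime p -> odd p -> n = (m + m).+1 ->
  signed_dual (xi R p) m f s g -> signed_dual (xi R p) m g t f -> DBF R f ->
  (forall rho, square_twist rho -> kernel_compatible (xi R p) q rho) ->
  (forall b, q b = q 0 -> b = 0) ->
  nondegenerate_subspace [set x | t x == e] r ->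
  ((n + 1) %/ 2 <= r <= n - 1)%N ->
  induces_symmetric_scheme (level_blocks q [set x | t x == e] f) <-> r = ((n + 1) %/ 2)%N.
Proof.
move=> p_pr p_odd nE fg gf [_ f0 [h [h0 coh fh]]] compat q0 [V [AE dimV _]].
move=> /andP[le_nr le_rn].
have z_prim := xi_prim R p_pr p_odd.
have [e' e'E] : exists e' : bool, eta (- 1 : 'F_p) = (-1) ^+ e'.
  by rewrite etaN1 // -signr_odd; exists (odd p./2).
have [g0 [g_even f_even] [rho [rho' [sq sq' sides]]]] :=
  dual_sides p_pr p_odd z_prim nE fg gf f0 h0 coh fh e'E.
have [H H'] := sides e.
have signK (b : bool) : ((-1) ^+ b * p%:Z ^+ m)%:~R ^+ 2 * p%:R = p%:R ^+ n :> R[i].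
  have -> : p%:R ^+ n = (p%:R ^+ m) ^+ 2 * p%:R :> R[i] by rewrite nE exprSr exprD expr2.
  by rewrite -rmorphXn exprMn sqrr_sign mul1r !rmorphXn.
have ccE : ((-1) ^+ (e (+) e') * p%:Z ^+ m)%:~R * ((-1) ^+ e * p%:Z ^+ m)%:~R *
    gauss p (xi R p) ^+ 2 = p%:R ^+ n.
  rewrite gauss_sqr // e'E -[RHS](signK false) expr0 mul1r rmorphXn /=.
  rewrite !rmorphM /= !rmorph_sign signr_addb rmorphXn /=.
  transitivity (((-1) ^+ e * (-1) ^+ e) * ((-1) ^+ e' * (-1) ^+ e') *
    (p%:R ^+ m) ^+ 2 * p%:R : R[i]); first by ring.
  by rewrite -!signr_addb !addbb !expr0 !mul1r.
have A0 : 0 \in [set x | t x == e] by rewrite AE inE mem0v.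
have AD x y : x \in [set x | t x == e] -> y \in [set x | t x == e] ->
    x + y \in [set x | t x == e].
  by rewrite AE !inE; apply: rpredD.
have AN x : x \in [set x | t x == e] -> - x \in [set x | t x == e].
  by rewrite AE !inE rpredN.
have cardA : #|[set x | t x == e]| = (p ^ r)%N.
  by rewrite AE cardsE card_vspace card_Fp // dimV.
apply: (level_blocks_scheme_dim p_pr p_odd z_prim H sq (compat _ sq) H' sq'
  (compat _ sq') q0 (signK _) (signK _) ccE f0 g0 f_even g_even A0 AD AN cardA _ _ le_nr).
  by rewrite nE in le_rn *; lia.
by rewrite nE /= addnn odd_double.
Qed.

Local Close Scope ring_scope.

Theorem proposition6 (R : realType) (p n : nat) (f : 'rV['F_p]_n -> 'F_p) :
  prime p -> odd p -> 3 <= n -> odd n ->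
  non_weakly_regular_bent R f -> DBF R f ->
  (forall r : nat,
     nondegenerate_subspace (Bplus R (dual R f)) r ->
     (n + 1) %/ 2 <= r <= n - 1 ->
     (induces_symmetric_scheme (Ppart R f) <-> r = (n + 1) %/ 2) /\
     (induces_symmetric_scheme (Dpart R f) <-> r = (n + 1) %/ 2)) /\
  (forall r : nat,
     nondegenerate_subspace (Bminus R (dual R f)) r ->
     (n + 1) %/ 2 <= r <= n - 1 ->
     (induces_symmetric_scheme (Ppart R f) <-> r = (n + 1) %/ 2) /\
     (induces_symmetric_scheme (Dpart R f) <-> r = (n + 1) %/ 2)).
Proof.
move=> p_pr p_odd n3 odd_n _ fDBF.
have nE : n = (n./2 + n./2).+1 by rewrite addnn -[LHS]odd_double_half odd_n.
have z_prim := xi_prim R p_pr p_odd.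
have [[fB gB] f0 [h [h0 coh fh]]] := fDBF.
have [s [g fg]] := bent_signed_dual p_pr p_odd z_prim nE (bent_norm fB).
rewrite (dualE p_pr p_odd nE fg) in gB.
have [t [f' gf']] := bent_signed_dual p_pr p_odd z_prim nE (bent_norm gB).
(* The dual of the dual is [f (- x)], and [f] is even. *)
have f'E : f' = f.
  apply/funext => x; rewrite (dual_dual p_pr p_odd z_prim nE fg gf').
  exact: (homogeneous_even p_odd h0 coh fh).
have gf := gf'; rewrite f'E in gf.
have [e [BpE BmE]] := Bplus_Bminus p_pr p_odd nE gf.
have BC : Bminus R (dual R f) = ~: Bplus R (dual R f).
  rewrite (dualE p_pr p_odd nE fg) BpE BmE; apply/setP => x; rewrite !inE.
  by case: (t x); case: (e).
have PE := PpartE f0 BC; have DE := DpartE f0 BC.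
have iffs e0 r : nondegenerate_subspace [set x | t x == e0] r ->
    (n + 1) %/ 2 <= r <= n - 1 ->
    (induces_symmetric_scheme (level_blocks id [set x | t x == e0] f)
      <-> r = (n + 1) %/ 2) /\
    (induces_symmetric_scheme (level_blocks (@quadratic_class p) [set x | t x == e0] f)
      <-> r = (n + 1) %/ 2).
  move=> ndA rB; split; apply: (level_blocks_scheme_iff p_pr p_odd nE fg gf fDBF) => //.
  - by move=> rho _; apply: kernel_compatible_id.
  - exact: kernel_compatible_quadratic.
  - exact: quadratic_class_eq0.
rewrite PE DE (dualE p_pr p_odd nE fg) BpE BmE; split=> r ndA rB; first exact: iffs.
(* The blocks do not distinguish a sign class from its complement, so B_- can take the place of
   [A]. *)
have eC : [set x | t x == e] = ~: [set x | t x == ~~ e].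
  by apply/setP => x; rewrite !inE; case: (t x); case: (e).
by rewrite eC !level_blocksC; apply: iffs.
Qed.
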